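(* Let $v_1,\dots,v_m\in\mathbb{Z}^n$ be in general position, i.e., every $n$ of them are linearly independent, and let $Z=\sum_{i=1}^m[0,v_i]$ be $n$-dimensional. Then for $1\le i\le n$, $$\mathrm{g}_i(Z)\leq\frac{\binom{m}{i}}{\binom{n}{i}}\,\sigma_i(Z).$$
   Context: $\mathrm{g}_i(Z)$ is the coefficient of $k^i$ in the Ehrhart polynomial $k\mapsto\#(kZ\cap\mathbb{Z}^n)$. For a $0$-symmetric convex body $K$, $\lambda_i(K)=\min\{\lambda>0:\dim(\lambda K\cap\mathbb{Z}^n)\ge i\}$ (dimension of affine hull). $DZ=Z-Z$, and $\sigma_i(Z)=\sigma_i(1/\lambda_1(DZ),\dots,1/\lambda_n(DZ))$ with $\sigma_i$ the $i$th elementary symmetric polynomial. *)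

(* Defs.v *)
From HB Require Import structures.
From mathcomp Require Import all_boot all_order all_algebra.
From mathcomp Require Import boolp classical_sets reals.
Set Implicit Arguments. Unset Strict Implicit. Unset Printing Implicit Defensive.
Import Order.TTheory GRing.Theory Num.Theory.
Local Open Scope ring_scope.
Local Open Scope classical_set_scope.

Section Defs.
Variables (R : realType) (n : nat).

Definition toR (z : 'rV[int]_n) : 'rV[R]_n := map_mx (fun a : int => a%:~R) z.

Definition zonotope (m : nat) (v : 'I_m -> 'rV[int]_n) : set 'rV[R]_n :=
  [set x | exists t : 'I_m -> R,
     (forall i, 0 <= t i <= 1) /\ x = \sum_(i < m) t i *: toR (v i)].

Definition diffset (S : set 'rV[R]_n) : set 'rV[R]_n :=
  [set x | exists y z, S y /\ S z /\ x = y - z].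

Definition dilate (c : R) (S : set 'rV[R]_n) : set 'rV[R]_n :=
  [set x | exists y, S y /\ x = c *: y].

Definition lattice_pts : set 'rV[R]_n := [set x | exists z, x = toR z].

Definition affdim_ge (S : set 'rV[R]_n) (d : nat) : Prop :=
  exists p : 'I_d.+1 -> 'rV[R]_n, (forall j, S (p j)) /\
    row_free (\matrix_(j < d) (p (lift ord0 j) - p ord0)).

Definition succ_min (K : set 'rV[R]_n) (i : nat) : R :=
  inf [set l : R | 0 < l /\ affdim_ge (dilate l K `&` lattice_pts) i].

Definition elem_sym (x : 'I_n -> R) (i : nat) : R :=
  \sum_(I : {set 'I_n} | #|I| == i) \prod_(j in I) x j.

Definition sigmaZ (m : nat) (v : 'I_m -> 'rV[int]_n) (i : nat) : R :=
  elem_sym (fun j : 'I_n => (succ_min (diffset (zonotope v)) j.+1)^-1) i.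

Definition lattice_card (S : set 'rV[R]_n) (N : nat) : Prop :=
  exists s : seq 'rV[int]_n, uniq s /\ (forall z, z \in s <-> S (toR z)) /\
    size s = N.

Definition general_position (m : nat) (v : 'I_m -> 'rV[int]_n) : Prop :=
  forall f : 'I_n -> 'I_m, injective f ->
    row_free (\matrix_(j < n) toR (v (f j))).

End Defs.

(* Main.v *)
(** Proof idea. Write [g E] for the index of [Z^E = (+)_(j in E) Z v_j] in
    [Z^n :&: span E]. Peeling off one generator [v_j] at a time, each line parallel to
    [v_j] gains a half-open segment of length [k |v_j|], i.e. one period modulo [k v_j];
    hence [#(kZ :&: Z^n) = \sum_(E independent) k^|E| g(E)], so the [i]-th coefficient is
    [\sum_(|E| = i) g(E)] (Stanley).

    Averaging over the [n]-subsets [J] reduces the claim to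
    [\sum_(E \subset J, |E| = i) g(E) <= sigma_i(Z)]. In the coordinates given by the basis
    [(v_j)_(j in J)], lattice points of small norm lie in a flag of subspaces; choosing
    linear forms that vanish on this flag and are triangular for a suitable ordering [pi]
    of [J] attaches the minimum [lambda_k] to the coordinate [pi k], and Minkowski's second
    theorem for the cube in the coordinate subspace of [E] yields
    [g(pi I) <= \prod_(k in I) 1 / lambda_k]. Summing over [I] gives [sigma_i].

    Minkowski's second theorem for the cube is proved by counting instead of volumes: a
    piecewise contraction of a large discrete cube along the flag has pairwise
    differences that avoid the lattice, and together with representatives of the lattice
    it injects into a finite torus. *)

Require Import Defs.
From HB Require Import structures.
From mathcomp Require Import all_boot all_order all_algebra.
From mathcomp Require Import boolp classical_sets reals.
From mathcomp Require Import zify ring lra.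
Import Order.TTheory GRing.Theory Num.Theory.
Local Open Scope ring_scope.
Set Implicit Arguments. Unset Strict Implicit. Unset Printing Implicit Defensive.

(** * Packing a discrete cube along a flag *)

(** The values [(x *m A) 0 k], over the [x] whose later coordinates vanish, form a subgroup of the
    integers, nonzero because [row k (\adj A)] yields [\det A]. An element of least nonzero absolute
    value generates it, by Euclidean division. *)
Lemma pivot_generator (e : nat) (A : 'M[int]_e) (k : 'I_e) :
  \det A != 0 ->
  exists w : 'rV[int]_e,
    [/\ forall i : 'I_e, (k < i)%N -> (w *m A) 0 i = 0, (w *m A) 0 k != 0
      & forall x : 'rV[int]_e, (forall i : 'I_e, (k < i)%N -> (x *m A) 0 i = 0) ->
          exists t : int, (x *m A) 0 k = t * (w *m A) 0 k].
Proof.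
move=> dA.
pose Q (x : 'rV[int]_e) := forall i : 'I_e, (k < i)%N -> (x *m A) 0 i = 0.
(* The shift [d.+1] builds nonvanishing into the quantity that is minimised. *)
pose P (d : nat) := `[< exists w, Q w /\ absz ((w *m A) 0 k) = d.+1 >].
have exP : exists d, P d.
  exists (absz (\det A)).-1; apply/asboolP; exists (row k (\adj A)); rewrite /Q.
  have E : row k (\adj A) *m A = row k (\det A)%:M by rewrite -row_mul mul_adj_mx.
  split; last by rewrite E !mxE eqxx mulr1n prednK // absz_gt0.
  by move=> i ki; rewrite E !mxE; case: eqP => // ek; rewrite ek ltnn in ki.
case: (ex_minnP exP) => d /asboolP[w [Qw wd]] dmin.
exists w; split => //; first by rewrite -absz_gt0 wd.
move=> x Qx; set c := (x *m A) 0 k; set u := (w *m A) 0 k; exists (c %/ u)%Z.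
have u0 : u != 0 by rewrite -absz_gt0 wd.
rewrite {1}(divz_eq c u); apply/eqP; rewrite -subr_eq0 addrAC subrr add0r.
apply/negP => /negP r0.
have E (i : 'I_e) : ((x - (c %/ u)%Z *: w) *m A) 0 i
    = (x *m A) 0 i - (c %/ u)%Z * (w *m A) 0 i.
  by rewrite mulmxBl -scalemxAl !mxE.
have Er : ((x - (c %/ u)%Z *: w) *m A) 0 k = (c %% u)%Z.
  by rewrite E -/c -/u {1}(divz_eq c u) addrAC subrr add0r.
have := dmin ((absz (c %% u)%Z).-1).
have -> : P ((absz (c %% u)%Z).-1).
  apply/asboolP; exists (x - (c %/ u)%Z *: w); split.
    by move=> i ki; rewrite E Qx // Qw // mulr0 subrr.
  by rewrite Er prednK // absz_gt0.
move=> /(_ isT); have := ltz_mod c u0; have := modz_ge0 c u0.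
move: wd r0; rewrite -/u.
by move: (c %% u)%Z => r; lia.
Qed.

Lemma mulmx_det_inj (D : idomainType) (e : nat) (A : 'M[D]_e) :
  \det A != 0 -> injective (fun x : 'rV[D]_e => x *m A).
Proof.
move=> dA x y /(congr1 (fun z => z *m \adj A)).
rewrite -!mulmxA mul_mx_adj !mul_mx_scalar => /rowP E; apply/rowP => i.
by apply: (mulfI dA); have := E i; rewrite !mxE.
Qed.

Lemma norm_subz_le (x y z : nat) : (x < z)%N -> (y < z)%N -> `|x%:Z - y%:Z| <= z%:Z.
Proof. by lia. Qed.

Section Packing.
Variables (e : nat) (A : 'M[int]_e) (a : 'I_e -> nat) (w : 'I_e -> 'rV[int]_e).
Hypothesis dA : \det A != 0.
Hypothesis a_mono : forall i j : 'I_e, (i <= j)%N -> (a i <= a j)%N.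
Hypothesis w_up : forall k i : 'I_e, (k < i)%N -> (w k *m A) 0 i = 0.
Hypothesis w_neq0 : forall k, (w k *m A) 0 k != 0.
Hypothesis w_gen : forall (k : 'I_e) (x : 'rV[int]_e),
  (forall i : 'I_e, (k < i)%N -> (x *m A) 0 i = 0) ->
  exists t : int, (x *m A) 0 k = t * (w k *m A) 0 k.
Variable L : nat.

Let cube := {ffun 'I_e -> 'I_L}.
Let pt (X : cube) : 'rV[int]_e := \row_i (X i : nat)%:Z.

Let same (j : nat) (X Y : cube) :=
  [forall i : 'I_e, (j <= i)%N ==> ((pt Y *m A) 0 i == (pt X *m A) 0 i)].

(** One chosen cube point per class modulo the [j]-th flag subspace: [pick] depends only on the
    class. The default [X] never occurs, since [X] lies in its own class. *)
Let rep (j : nat) (X : cube) : cube := odflt X [pick Y | same j X Y].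

Let rep_same j X (i : 'I_e) : (j <= i)%N -> (pt (rep j X) *m A) 0 i = (pt X *m A) 0 i.
Proof.
rewrite /rep; case: pickP => [Y /forallP /(_ i) /implyP h ji|//].
by apply/eqP/h.
Qed.

Let rep_eq j X Y :
  (forall i : 'I_e, (j <= i)%N -> (pt X *m A) 0 i = (pt Y *m A) 0 i) -> rep j X = rep j Y.
Proof.
move=> h; rewrite /rep.
have -> : [pick Z | same j Y Z] = [pick Z | same j X Z].
  apply: eq_pick => Z; apply: eq_forallb => i /=.
  by case ji: (j <= i)%N => //=; rewrite h.
case: pickP => // /(_ X) /negP[]; apply/forallP => i; apply/implyP => _; exact: eqxx.
Qed.

(** The sequence [a] preceded by 0, so that the increments up to index [k] telescope to [a k]. *)
Let b (j : nat) : nat := if j is j'.+1 then oapp a 0%N (insub j') else 0%N.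

Let b_ord (k : 'I_e) : b k.+1 = a k.
Proof. by rewrite /b insubT //= => H; congr a; apply: val_inj. Qed.

Let b_mono (k : 'I_e) : (b k <= b k.+1)%N.
Proof.
rewrite b_ord; case: k => -[|k] hk //.
have hk' : (k < e)%N by apply: ltn_trans hk.
by rewrite -[k]/(val (Ordinal hk')) b_ord; apply: a_mono => /=.
Qed.

Let sum_b (k : 'I_e) : \sum_(j < e | (j <= k)%N) ((b j.+1)%:Z - (b j)%:Z) = (a k)%:Z.
Proof.
rewrite (eq_bigl (fun j : 'I_e => (j < k.+1)%N)) //.
rewrite -(big_ord_widen e (fun j => (b j.+1)%:Z - (b j)%:Z)) //.
by rewrite -(big_mkord xpredT (fun j => (b j.+1)%:Z - (b j)%:Z)) telescope_sumr // b_ord subr0.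
Qed.

(* The classical map [\sum_j (lambda_j - lambda_(j-1)) c_j(x)], where [c_j] depends only on
   [x] modulo the [j]-th subspace of the flag [{x | (x A)_i = 0 for i >= j}]. *)
Let shrink (X : cube) : 'rV[int]_e :=
  \sum_(j < e) ((b j.+1)%:Z - (b j)%:Z) *: pt (rep j X).

(* [shrink] dilates by [a k] in the [k]-th flag direction; the cells fill the gaps. *)
Let cell (r : {dffun forall k : 'I_e, 'I_(a k)}) : 'rV[int]_e :=
  \sum_(k < e) (r k : nat)%:Z *: w k.

Definition packing_pt (Xr : {ffun 'I_e -> 'I_L} * {dffun forall k : 'I_e, 'I_(a k)}) :=
  shrink Xr.1 + cell Xr.2.

(** Bounds the coordinates of a difference of two cells, independently of [L], hence is negligible
    for large cubes. *)
Definition packing_slack : nat := (\sum_(k < e) a k * \sum_(i < e) absz (w k ord0 i))%N.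

Let cell_norm r r' i : `|(cell r - cell r') 0 i| <= packing_slack%:Z.
Proof.
rewrite /cell -sumrB summxE (le_trans (ler_norm_sum _ _ _)) //.
rewrite /packing_slack raddf_sum /= ler_sum // => k _.
rewrite -scalerBl mxE normrM PoszM ler_pM //.
  exact: norm_subz_le (ltn_ord _) (ltn_ord _).
by rewrite (bigD1 i) //= -abszE PoszD lerDl.
Qed.

(** Let [k] be the largest index where the images under [A] or the cell digits differ. All terms
    beyond [k] cancel, which gives the norm bound. The [k]-th coordinate is the pivot times
    [a k * t + (r k - s k)], and since the digits differ by less than [a k], this is zero only if
    [t = 0] and [r k = s k]. *)
Lemma packing_diff (Xr Ys : {ffun 'I_e -> 'I_L} * {dffun forall k : 'I_e, 'I_(a k)}) :
  Xr != Ys ->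
  exists k : 'I_e, ((packing_pt Xr - packing_pt Ys) *m A) 0 k != 0 /\
    forall i, `|(packing_pt Xr - packing_pt Ys) 0 i| <= (a k * L.-1 + packing_slack)%:Z.
Proof.
case: Xr Ys => [X r] [Y s] neq; rewrite /packing_pt /=.
pose dif (k : 'I_e) := ((pt X *m A) 0 k != (pt Y *m A) 0 k) || (r k != s k).
have [k0 dk0] : exists k, dif k.
  apply/existsP; apply: contraNT neq; rewrite negb_exists => /forallP h.
  have hX (k : 'I_e) : (pt X *m A) 0 k = (pt Y *m A) 0 k.
    by have := h k; rewrite negb_or => /andP[/negPn/eqP].
  have hr (k : 'I_e) : r k = s k by have := h k; rewrite negb_or => /andP[_ /negPn/eqP].
  have EX : pt X *m A = pt Y *m A by apply/rowP.
  have /rowP EX' := mulmx_det_inj dA EX.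
  have -> : X = Y by apply/ffunP => i; apply/val_inj; have := EX' i; rewrite !mxE => -[].
  by apply/eqP; congr pair; apply/ffunP => i; apply: hr.
have [k dk kmax] : exists2 k, dif k & forall j, dif j -> (j <= k)%N.
  by case: (arg_maxnP (fun j : 'I_e => j : nat) dk0) => j dj h; exists j.
have nX (i : 'I_e) : (k < i)%N -> (pt X *m A) 0 i = (pt Y *m A) 0 i.
  by move=> ki; apply/eqP; apply/negPn/negP => h; have := kmax i; rewrite /dif h leqNgt ki => /(_ isT).
have nr (i : 'I_e) : (k < i)%N -> r i = s i.
  move=> ki; apply/eqP; apply/negPn/negP => h.
  by have := kmax i; rewrite /dif h orbT leqNgt ki => /(_ isT).
have Es : shrink X - shrink Y = \sum_(j < e | (j <= k)%N)
   ((b j.+1)%:Z - (b j)%:Z) *: (pt (rep j X) - pt (rep j Y)).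
  rewrite /shrink -sumrB [RHS]big_mkcond /=; apply: eq_bigr => j _; rewrite -scalerBr.
  case: leqP => // kj; rewrite (_ : rep j X = rep j Y) ?subrr ?scaler0 //.
  by apply: rep_eq => i ji; apply: nX; apply: leq_trans ji.
exists k; rewrite opprD addrACA; split; last first.
  move=> i; rewrite mxE (le_trans (ler_normD _ _)) // PoszD lerD ?cell_norm //.
  rewrite Es summxE (le_trans (ler_norm_sum _ _ _)) // PoszM -sum_b mulr_suml ler_sum // => j _.
  rewrite mxE normrM ler_pM //; first by have := b_mono j; lia.
  rewrite !mxE; have := ltn_ord (rep j X i); have := ltn_ord (rep j Y i); lia.
rewrite mulmxDl mxE Es mulmx_suml summxE.
(* For [j <= k], passing to representatives leaves the [k]-th coordinate unchanged, so it factors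
   out of the telescoping sum. *)
have -> : \sum_(j < e | (j <= k)%N)
   (((b j.+1)%:Z - (b j)%:Z) *: (pt (rep j X) - pt (rep j Y)) *m A) 0 k
    = (a k)%:Z * (((pt X - pt Y) *m A) 0 k).
  rewrite -sum_b mulr_suml; apply: eq_bigr => j jk.
  by rewrite -scalemxAl mxE !mulmxBl [in LHS]mxE [in RHS]mxE ![(- (_ *m A)) 0 k]mxE !rep_same.
have -> : ((cell r - cell s) *m A) 0 k = ((r k : nat)%:Z - (s k : nat)%:Z) * (w k *m A) 0 k.
  rewrite /cell -sumrB mulmx_suml summxE (bigD1 k) //= big1 ?addr0.
    by rewrite -scalerBl -scalemxAl mxE.
  move=> j; rewrite neq_ltn -scalerBl -scalemxAl mxE => /orP[jk|kj].
    by rewrite w_up ?mulr0.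
  by rewrite nr // subrr mul0r.
have [i ki|t Et] := @w_gen k (pt X - pt Y).
  by rewrite mulmxBl mxE [X in _ + X]mxE nX // subrr.
rewrite Et mulrA -mulrDl mulf_neq0 //.
apply/eqP => H.
have t0 : t = 0.
  have := ltn_ord (r k); have := ltn_ord (s k); nia.
move: dk; rewrite /dif; move: Et; rewrite t0 mul0r mulmxBl mxE [X in _ + X]mxE => /eqP.
rewrite subr_eq0 => /eqP ->; rewrite eqxx /= => /negP; apply; apply/eqP/val_inj => /=; lia.
Qed.
End Packing.

(** * Minkowski's second theorem for the cube, by counting *)

(** Bernoulli's inequality for [(1 - 1/(K+1))^e], cleared of denominators. *)
Lemma bernoulli_nat (K e : nat) : (K.+1 ^ e.+1 <= K ^ e * K.+1 + e * K.+1 ^ e)%N.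
Proof.
elim: e => [|e IH]; first by rewrite !expn0 expn1 mul1n mul0n addn0.
have h : (K ^ e <= K.+1 ^ e)%N by case: (e) => // e'; rewrite leq_exp2r.
rewrite expnS; apply: leq_trans (leq_mul (leqnn K.+1) IH) _.
rewrite !expnS; move: (K ^ e)%N (K.+1 ^ e)%N h => x y h; nia.
Qed.

(** A limit in [K] made finite: for [K = e * X + 1], Bernoulli gives
    [(K+1) * (X - Y) <= e * X < K+1]. *)
Lemma leq_of_asymptotic_expn (e X Y : nat) :
  (forall K, (0 < K)%N -> (K ^ e * X <= K.+1 ^ e * Y)%N) -> (X <= Y)%N.
Proof.
move=> h; rewrite leqNgt; apply/negP => ltYX.
have := bernoulli_nat (e * X).+1 e; have := h (e * X).+1 isT.
have p0 : (0 < (e * X).+2 ^ e)%N by rewrite expn_gt0.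
rewrite expnS; move: ((e * X).+2 ^ e)%N ((e * X).+1 ^ e)%N p0 => u t u0 h1 h2.
have h3 : ((e * X).+2 * u * X <= (e * X).+2 * u * Y + e * u * X)%N.
  apply: leq_trans (leq_mul h2 (leqnn X)) _.
  by rewrite mulnDl leq_add2r mulnAC mulnC -mulnA leq_mul2l h1.
have h4 : ((e * X).+2 * (Y.+1) <= (e * X).+2 * Y + e * X)%N.
  rewrite -(leq_pmul2l u0); apply: leq_trans (leq_trans h3 _).
    by rewrite mulnA (mulnC u) leq_mul2l ltYX orbT.
  by rewrite (_ : _ + _ = u * ((e * X).+2 * Y + e * X))%N //; ring.
by move: h4; rewrite mulnS; lia.
Qed.

Lemma modz_inord_inj (Q : nat) (x y : int) : (0 < Q)%N ->
  (inord (absz (x %% Q%:Z)%Z) : 'I_Q.-1.+1) = inord (absz (y %% Q%:Z)%Z) ->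
  exists t, x - y = Q%:Z * t.
Proof.
move=> Q0 /(congr1 (fun i => nat_of_ord i)).
have Q1 : Q%:Z != 0 by lia.
have lt z : (absz (z %% Q%:Z)%Z < Q.-1.+1)%N.
  rewrite prednK //; have := ltz_pmod z (d := Q%:Z) Q0; have := modz_ge0 z Q1.
  by move: (z %% Q%:Z)%Z => s; lia.
rewrite !inordK // => E; exists ((x %/ Q%:Z)%Z - (y %/ Q%:Z)%Z).
have := modz_ge0 x Q1; have := modz_ge0 y Q1 => hx hy.
rewrite [in LHS](divz_eq x Q%:Z) [in LHS](divz_eq y Q%:Z); move: E hx hy.
by move: (x %% Q%:Z)%Z (y %% Q%:Z)%Z => s t; lia.
Qed.

(** Here [Lam] is a lattice between [q Z^e] and [Z^e], with [g] classes exhibited modulo [q], and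
    [a] plays the role of its minima for the sup norm. Packing points translated by [N *: gam i]
    stay distinct modulo [N * q]: a coincidence would give a vector of [Lam] shorter than its
    minimum. Comparing cardinalities and letting [K] grow gives the bound. *)
Lemma minkowski_second_cube (e q g : nat) (A : 'M[int]_e) (a : 'I_e -> nat)
    (Lam : 'rV[int]_e -> Prop) (gam : 'I_g -> 'rV[int]_e) :
  \det A != 0 -> (0 < q)%N -> (forall k, 0 < a k)%N ->
  (forall i j : 'I_e, (i <= j)%N -> (a i <= a j)%N) ->
  (forall x y, Lam x -> Lam y -> Lam (x - y)) -> (forall y : 'rV[int]_e, Lam (q%:Z *: y)) ->
  (forall x, Lam x -> forall t, (x *m A) 0 t != 0 -> exists i, (a t)%:Z <= `|x 0 i|) ->
  (forall i, Lam (gam i)) -> (forall i j (y : 'rV[int]_e), gam i - gam j = q%:Z *: y -> i = j) ->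
  (g * \prod_k a k <= q ^ e)%N.
Proof.
move=> dA q0 a0 amono LamB Lamq Lama Lamg gam_inj.
have [w /all_and3[w_up w_neq0 w_gen]] := choice (fun k => pivot_generator k dA).
apply: (@leq_of_asymptotic_expn e) => K K0.
(* As [C] exceeds the slack, [N * a k] exceeds [a k * L.-1 + packing_slack], while the ratio
   [L / N = K / K.+1] tends to 1. *)
set C := (packing_slack a w).+1; pose L := (C * K)%N; pose N := (C * K.+1)%N.
have N0 : (0 < N)%N by rewrite muln_gt0.
pose Nq := (N * q)%N; have Nq0 : (0 < Nq)%N by rewrite muln_gt0 N0.
pose T : finType := ({ffun 'I_e -> 'I_L} * {dffun forall k : 'I_e, 'I_(a k)} * 'I_g)%type.
pose F (u : T) : 'rV[int]_e := packing_pt A w u.1 + N%:Z *: gam u.2.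
pose f (u : T) : {ffun 'I_e -> 'I_Nq.-1.+1} := [ffun i => inord (absz (F u ord0 i %% Nq%:Z)%Z)].
have finj : injective f.
  move=> u1 u2 /ffunP E.
  have [y Ey] : exists y : 'rV[int]_e, F u1 - F u2 = Nq%:Z *: y.
    have [y hy] := choice (fun i => modz_inord_inj Nq0 (etrans (esym (ffunE _ i)) (etrans (E i) (ffunE _ i)))).
    by exists (\row_i y i); apply/rowP => i; rewrite mxE [X in _ + X]mxE hy !mxE.
  have Ed : packing_pt A w u1.1 - packing_pt A w u2.1
      = N%:Z *: (q%:Z *: y - (gam u1.2 - gam u2.2)).
    rewrite [RHS]scalerBr scalerA -PoszM -/Nq -Ey /F [X in _ = _ - X]scalerBr.
    by rewrite [X in _ = X - _](_ : _ = packing_pt A w u1.1 - packing_pt A w u2.1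
      + (N%:Z *: gam u1.2 - N%:Z *: gam u2.2)) ?addrK // opprD addrACA.
  case: u1 u2 {E} Ed Ey => [Xr i] [Ys j] /= Ed Ey.
  have EX : Xr = Ys.
    apply/eqP/negPn/negP => neq.
    have [k [knz kle]] := packing_diff dA amono w_up w_neq0 w_gen neq.
    set z := _ - (gam i - gam j) in Ed.
    have Lz : Lam z by apply: (LamB) => //; apply: (LamB).
    have [s hs] : exists s, (a k)%:Z <= `|z 0 s|.
      apply: Lama => //; apply: contraNneq knz => Z0.
      by rewrite Ed -scalemxAl mxE Z0 mulr0.
    have := kle s; rewrite Ed mxE normrM.
    have : N%:Z * (a k)%:Z <= `|N%:Z| * `|z 0 s| by rewrite ler_pM.
    move=> h1 h2; have := le_trans h1 h2.
    rewrite -PoszM lez_nat /N -/C => h3.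
    have := a0 k; have : (0 < L)%N by rewrite muln_gt0.
    move: h3; rewrite /L mulnS /C; move: (packing_slack a w) => c.
    case: (c.+1 * K)%N => // M h3 _ ak.
    have : (c.+1 <= c.+1 * a k)%N by rewrite leq_pmulr.
    by move: h3; rewrite /= mulnDl [(M.+1 * _)%N]mulnC [(a k * M.+1)%N]mulnS; lia.
  rewrite EX; congr pair; apply: (gam_inj _ _ y); move: Ed.
  rewrite EX subrr => /esym /rowP Ed; apply/eqP; rewrite eq_sym -subr_eq0.
  apply/eqP/rowP => s; have /eqP := Ed s; rewrite [X in X == _]mxE [X in _ == X]mxE mulf_eq0.
  by rewrite eqz_nat (gtn_eqF N0) /= => /eqP ->; rewrite !mxE.
have := leq_card f finj.
rewrite !card_prod !card_ffun !card_ord prednK // card_dep_ffun foldrE big_map big_enum /=.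
under eq_bigr do rewrite card_ord.
rewrite /Nq /L /N !expnMn -!mulnA leq_pmul2l ?expn_gt0 // => h.
by rewrite [(g * _)%N]mulnC.
Qed.

(** * Integer vectors as real vectors *)

Section Lattice.
Variables (R : realType) (n : nat).

Lemma toRD (x y : 'rV[int]_n) : toR R (x + y) = toR R x + toR R y.
Proof. by apply/rowP => i; rewrite !mxE rmorphD. Qed.

Lemma toRZ c (x : 'rV[int]_n) : toR R (c *: x) = c%:~R *: toR R x.
Proof. by apply/rowP => i; rewrite !mxE rmorphM. Qed.

Lemma toRB (x y : 'rV[int]_n) : toR R (x - y) = toR R x - toR R y.
Proof. by apply/rowP => i; rewrite !mxE rmorphB. Qed.

Lemma toR0 : toR R (0 : 'rV[int]_n) = 0.
Proof. by apply/rowP => i; rewrite !mxE. Qed.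

Lemma toR_sum I (r : seq I) (P : pred I) (F : I -> 'rV[int]_n) :
  toR R (\sum_(i <- r | P i) F i) = \sum_(i <- r | P i) toR R (F i).
Proof.
by rewrite (big_morph _ toRD toR0).
Qed.

Lemma toR_inj : injective (@toR R n).
Proof. by move=> x y /rowP E; apply/rowP => i; have := E i; rewrite !mxE => /intr_inj. Qed.

End Lattice.

(** * Slabs and representatives modulo sublattices *)

(** A duplicate-free system of representatives of [T] modulo [K]; its size counts the lattice points
    of [T] modulo [K]. *)
Definition transversal n (T K : 'rV[int]_n -> Prop) (s : seq 'rV[int]_n) :=
  [/\ forall z, z \in s -> T z,
      forall z, T z -> exists2 y, y \in s & K (z - y),
      {in s &, forall y z, K (y - z) -> y = z} & uniq s].

Section Slabs.
Variables (R : realType) (n m : nat) (v : 'I_m -> 'rV[int]_n).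
Implicit Types (D E F : {set 'I_m}) (t : 'I_m -> R) (c : 'I_m -> int).

Definition comb t : 'rV[R]_n := \sum_j t j *: toR R (v j).
Definition combz c : 'rV[int]_n := \sum_j c j *: v j.

(** For disjoint [D] and [E], this is the [k]-fold zonotope on [D] plus the real span of [E]. It
    interpolates between the dilated zonotope ([E] empty) and the span ([D] empty). *)
Definition slab (k : R) D E (x : 'rV[R]_n) : Prop :=
  exists t, [/\ x = comb t, forall j, j \in D -> 0 <= t j <= k
              & forall j, j \notin D :|: E -> t j = 0].

Definition sublattice (k : nat) E (z : 'rV[int]_n) : Prop :=
  exists2 c, forall j, j \notin E -> c j = 0 & z = k%:Z *: combz c.

Definition indep E : Prop :=
  forall t, (forall j, j \notin E -> t j = 0) -> comb t = 0 -> forall j, t j = 0.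

Lemma combD t u : comb (fun j => t j + u j) = comb t + comb u.
Proof. by rewrite /comb -big_split; apply: eq_bigr => j _; rewrite scalerDl. Qed.

Lemma combZ a t : comb (fun j => a * t j) = a *: comb t.
Proof. by rewrite /comb scaler_sumr; apply: eq_bigr => j _; rewrite scalerA. Qed.

Lemma combN t : comb (fun j => - t j) = - comb t.
Proof. by rewrite /comb -sumrN; apply: eq_bigr => j _; rewrite scaleNr. Qed.

Lemma comb1 j a : comb (fun i => if i == j then a else 0) = a *: toR R (v j).
Proof.
rewrite /comb (bigD1 j) //= eqxx big1 ?addr0 // => i /negbTE ->.
by rewrite scale0r.
Qed.

Lemma combzB c d : combz (fun j => c j - d j) = combz c - combz d.
Proof. by rewrite /combz -sumrB; apply: eq_bigr => j _; rewrite scalerBl. Qed.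

Lemma combz1 j a : combz (fun i => if i == j then a else 0) = a *: v j.
Proof.
rewrite /combz (bigD1 j) //= eqxx big1 ?addr0 // => i /negbTE ->.
by rewrite scale0r.
Qed.

Lemma toR_combz c : toR R (combz c) = comb (fun j => (c j)%:~R).
Proof. by rewrite /combz toR_sum; apply: eq_bigr => j _; rewrite toRZ. Qed.

Lemma indepW D E : D \subset E -> indep E -> indep D.
Proof. by move=> /fintype.subsetP DE iE t tD; apply: iE => j jE; apply: tD; apply: contra jE; apply: DE. Qed.

Lemma indep_dep E j : indep E -> ~ indep (j |: E) ->
  exists2 t, forall i, i \notin E -> t i = 0 & toR R (v j) = comb t.
Proof.
move=> iE /existsNP[t /not_implyP[tE /not_implyP[t0 /existsNP[i ti]]]].
have tj : t j != 0.
  apply/eqP => tj; apply: ti; apply: iE => // l lE.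
  by have [->//|lj] := eqVneq l j; apply: tE; rewrite !inE negb_or lj.
exists (fun l => if l == j then 0 else - (t j)^-1 * t l).
  move=> l lE; case: eqVneq => // lj; rewrite [t l]tE ?mulr0 //.
  by rewrite !inE negb_or lj.
have -> : comb (fun l => if l == j then 0 else - (t j)^-1 * t l)
  = comb (fun l => - (t j)^-1 * t l + (if l == j then 1 else 0)).
  apply: eq_bigr => l _; case: eqVneq => [->|_]; last by rewrite addr0.
  by rewrite mulNr mulVf // addNr.
by rewrite combD combZ t0 scaler0 add0r comb1 scale1r.
Qed.

(** Independence puts [v j] outside the row space spanned by [E], so some column of the cokernel
    does not vanish on it; that column is rescaled. *)
Lemma dual_functional E j : j \notin E -> indep (j |: E) ->
  exists2 f : 'cV[R]_n, forall i, i \in E -> (toR R (v i) *m f) 0 0 = 0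
    & (toR R (v j) *m f) 0 0 = 1.
Proof.
move=> jE iE.
pose B : 'M[R]_(m, n) := \matrix_(i < m) (if i \in E then toR R (v i) else 0).
have Bi i : i \in E -> row i B = toR R (v i) by move=> iE'; rewrite rowK iE'.
have [] := boolP (toR R (v j) <= B)%MS.
  move=> /submxP[c Ec]; exfalso.
  pose t i := (if i == j then -1 else 0) + (if i \in E then c 0 i else 0).
  have := iE t _ _ j; rewrite /t eqxx (negbTE jE) addr0 => H.
  suff : (-1 : R) = 0 by move/eqP; rewrite oppr_eq0 oner_eq0.
  apply: H => [i|].
    by rewrite !inE negb_or => /andP[/negbTE -> /negbTE ->]; rewrite addr0.
  rewrite combD comb1 scaleN1r Ec mulmx_sum_row addrC; apply/eqP; rewrite subr_eq0.
  apply/eqP; apply: eq_bigr => i _; rewrite rowK.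
  by case: ifP => // _; rewrite scaler0 scale0r.
rewrite submxE => nz.
have /matrix0Pn[i0 [l nzl]] := nz; rewrite {i0}[i0]ord1 in nzl.
exists (((toR R (v j) *m cokermx B) 0 l)^-1 *: col l (cokermx B)).
  move=> i iE'; rewrite -scalemxAr -(Bi i) // mxE colE -row_mul (mulmxA B (cokermx B)) mulmx_coker.
  by rewrite mul0mx row0 [X in _ * X]mxE mulr0.
by rewrite -scalemxAr mxE colE (mulmxA (toR R (v j)) (cokermx B)) -colE [X in _ * X]mxE mulVf.
Qed.

Lemma slabU1 k D E j x : j \notin D -> j \notin E ->
  slab k (j |: D) E x <-> exists2 s, 0 <= s <= k & slab k D E (x - s *: toR R (v j)).
Proof.
move=> jD jE; split=> [[t [-> tD t0]]|[s s01 [t [Ex tD t0]]]].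
  exists (t j); first by apply: tD; rewrite !inE eqxx.
  exists (fun i => if i == j then 0 else t i); split.
  - rewrite -scaleNr -comb1 -combD; apply: eq_bigr => i _.
    by case: eqVneq => [->|]; rewrite ?subrr ?addr0.
  - move=> i iD; have [ij|ij] := eqVneq i j; first by rewrite -ij iD in jD.
    by apply: tD; rewrite !inE iD orbT.
  - move=> i; have [//|ij] := eqVneq i j => iDE; apply: t0.
    by move: iDE; rewrite !inE !negb_or ij.
have tj : t j = 0 by apply: t0; rewrite !inE negb_or jD.
exists (fun i => t i + (if i == j then s else 0)); split.
- by rewrite combD -Ex comb1 subrK.
- move=> i; rewrite !inE; have [->|ij] := eqVneq i j; first by rewrite tj add0r.
  by rewrite addr0; apply: tD.
- move=> i; rewrite !inE; have [->|ij] := eqVneq i j => //=; rewrite addr0 => h.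
  by apply: t0; rewrite inE.
Qed.

Lemma slab_span k D E j x : j \notin D -> j \notin E ->
  slab k D (j |: E) x <-> exists s, slab k D E (x + s *: toR R (v j)).
Proof.
move=> jD jE; split=> [[t [-> tD t0]]|[s [t [Ex tD t0]]]].
  exists (- t j).
  exists (fun i => if i == j then 0 else t i); split.
  - rewrite -comb1 -combD; apply: eq_bigr => i _.
    by case: eqVneq => [->|]; rewrite ?subrr ?addr0.
  - move=> i iD; have [ij|ij] := eqVneq i j; first by rewrite -ij iD in jD.
    exact: tD.
  - move=> i; have [//|ij] := eqVneq i j => iDE; apply: t0.
    by move: iDE; rewrite !inE !negb_or ij.
exists (fun i => t i + (if i == j then - s else 0)); split.
- by rewrite combD -Ex comb1 scaleNr addrK.
- move=> i iD; have [ij|ij] := eqVneq i j; first by rewrite -ij iD in jD.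
  by rewrite addr0; apply: tD.
- move=> i; rewrite !inE !negb_or; have [->|ij] := eqVneq i j => //=; first by rewrite andbF.
  by rewrite addr0 => h; apply: t0; rewrite inE negb_or.
Qed.

(** Convexity of slabs: [c] is the barycentre of [a] and [b] with weights [l] and [l']. *)
Lemma slab_segment k D E (x u : 'rV[R]_n) (a b c : R) : a <= c -> c <= b ->
  slab k D E (x + a *: u) -> slab k D E (x + b *: u) -> slab k D E (x + c *: u).
Proof.
move=> ac cb [t [Et tD t0]] [s [Es sD s0]].
have [ab|ab] := eqVneq a b.
  by exists t; split=> //; rewrite -Et; congr (_ + _ *: _); lra.
have ba : 0 < b - a by rewrite subr_gt0 lt_neqAle ab (le_trans ac).
have bn : b - a != 0 by rewrite gt_eqF.
pose l := (b - c) / (b - a); pose l' := (c - a) / (b - a).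
have l0 : 0 <= l by rewrite divr_ge0 ?subr_ge0 // -subr_ge0 ltW.
have l'0 : 0 <= l' by rewrite divr_ge0 ?subr_ge0 // -subr_ge0 ltW.
have ll : l + l' = 1 by rewrite /l /l'; field.
exists (fun j => l * t j + l' * s j); split.
- rewrite combD !combZ -Et -Es !scalerDr addrACA -scalerDl ll scale1r !scalerA -scalerDl.
  by congr (_ + _ *: _); rewrite /l /l'; field.
- move=> j jD; have := tD j jD; have := sD j jD => /andP[h1 h2] /andP[h3 h4].
  apply/andP; split; nra.
- by move=> j jD; rewrite t0 // s0 // !mulr0 addr0.
Qed.

Lemma slab_addE k D E t x : (forall j, j \notin E -> t j = 0) -> [disjoint D & E] ->
  slab k D E x -> slab k D E (x + comb t).
Proof.
move=> tE /pred0P dDE [s [-> sD s0]]; exists (fun j => s j + t j); split.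
- by rewrite combD.
- move=> j jD; rewrite tE ?addr0; first exact: sD.
  by have /= := dDE j; rewrite jD /= => ->.
- move=> j; rewrite inE negb_or => /andP[jD jE].
  by rewrite s0 ?tE ?addr0 // inE negb_or jD.
Qed.

(** The functional dual to [v j] ignores the span of [E] and is bounded on the zonotope part, hence
    bounds [s]. *)
Lemma slab_bounded k D E j x : j \notin E -> indep (j |: E) ->
  exists B, forall s, slab k D E (x + s *: toR R (v j)) -> s <= B.
Proof.
move=> jE /(dual_functional jE)[f fE fj].
exists (\sum_(i in D) `|k| * `|(toR R (v i) *m f) 0 0| - (x *m f) 0 0).
move=> s [t [Et tD t0]]; rewrite lerBrDl.
have -> : (x *m f) 0 0 + s = \sum_(i in D) t i * (toR R (v i) *m f) 0 0.
  have := congr1 (fun z => (z *m f) 0 0) Et.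
  rewrite mulmxDl -scalemxAl mxE [X in _ + X]mxE fj mulr1 => ->.
  rewrite /comb mulmx_suml summxE [RHS]big_mkcond; apply: eq_bigr => i _.
  rewrite -scalemxAl mxE; case: ifP => // /negbT iD.
  have [iE|iE] := boolP (i \in E); first by rewrite fE ?mulr0.
  by rewrite t0 ?mul0r // inE negb_or iD.
apply: ler_sum => i iD; rewrite (le_trans (ler_norm _)) // normrM ler_wpM2r //.
by have /andP[h1 h2] := tD i iD; rewrite !ger0_norm // (le_trans h1).
Qed.

(* On the line [x + R v_j], [slab k (j |: D) E] is an interval [J + [0, k]] and [slab k D E] is
   [J], so the difference is a half-open interval of length [k]. *)
Lemma unique_shift (k : nat) D E j x : (0 < k)%N -> j \notin D -> j \notin E ->
  indep (j |: E) -> slab k%:R D (j |: E) x ->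
  exists c : int,
    [/\ slab k%:R (j |: D) E (x + (c%:~R * k%:R) *: toR R (v j)),
        ~ slab k%:R D E (x + (c%:~R * k%:R) *: toR R (v j))
      & forall c' : int, slab k%:R (j |: D) E (x + (c'%:~R * k%:R) *: toR R (v j)) ->
          ~ slab k%:R D E (x + (c'%:~R * k%:R) *: toR R (v j)) -> c' = c].
Proof.
move=> k0 jD jE iE /(slab_span _ _ jD jE)[t0 Jt0].
set u := toR R (v j) in Jt0 *.
have [B Bub] := @slab_bounded k%:R D E j x jE iE.
have kR : 0 < k%:R :> R by rewrite ltr0n.
(* An integer with [c0 * k <= t0], from which the multiples of [k] reached by the interval are
   counted. *)
pose c0 : int := - (Num.bound (`|t0| / k%:R))%:Z.
pose P i := `[< exists2 t, slab k%:R D E (x + t *: u) & (c0 + i%:Z)%:~R * k%:R <= t >].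
have exP : exists i, P i.
  exists 0%N; apply/asboolP; exists t0 => //.
  rewrite addr0 rmorphN /= mulNr lerNl.
  have := archi_boundP (divr_ge0 (normr_ge0 t0) (ltW kR)).
  rewrite ltr_pdivrMr // => /ltW h; apply: le_trans h.
  by rewrite -normrN ler_norm.
pose M := Num.bound (`|B - c0%:~R * k%:R| / k%:R).
have ubP i : P i -> (i <= M)%N.
  move=> /asboolP[t Jt h]; have tB := Bub t Jt.
  have := archi_boundP (divr_ge0 (normr_ge0 (B - c0%:~R * k%:R)) (ltW kR)).
  rewrite ltr_pdivrMr // => h2; rewrite ltnW // -(ltr_nat R) -(ltr_pM2r kR).
  apply: le_lt_trans h2; apply: le_trans (ler_norm _).
  rewrite lerBrDr -[i%:R]/((i%:Z)%:~R) -mulrDl -rmorphD /= addrC.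
  exact: le_trans tB.
case: (ex_maxnP exP ubP) => i /asboolP[t Jt ht] imax.
have nJ s : (c0 + i.+1%:Z)%:~R * k%:R <= s -> ~ slab k%:R D E (x + s *: u).
  move=> hs Js; suff : P i.+1 by move/imax; rewrite ltnn.
  by apply/asboolP; exists s.
have lift (c : int) : slab k%:R (j |: D) E (x + (c%:~R * k%:R) *: u) ->
  exists s, [/\ c%:~R * k%:R - k%:R <= s, s <= c%:~R * k%:R & slab k%:R D E (x + s *: u)].
  move=> /(slabU1 _ _ jD jE)[r /andP[r0 rk]].
  rewrite -addrA -scaleNr -scalerDl => h.
  by exists (c%:~R * k%:R - r); split=> //; lra.
(* Of two multiples of [k] in [J + [0, k]], the smaller one lies between two points of [J], so only
   the largest can be outside [J]. *)
have uniqC (c c' : int) : (c < c')%R -> slab k%:R (j |: D) E (x + (c'%:~R * k%:R) *: u) ->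
  slab k%:R (j |: D) E (x + (c%:~R * k%:R) *: u) -> slab k%:R D E (x + (c%:~R * k%:R) *: u).
  move=> cc' /lift[s [s1 s2 Js]] /lift[r [r1 r2 Jr]].
  apply: slab_segment r2 _ Jr Js; apply: le_trans s1.
  rewrite lerBrDr -[X in _ + X]mul1r -mulrDl ler_pM2r // -[1]/(1%:~R) -rmorphD ler_int.
  by rewrite lezD1.
(* Some point of [J] reaches [(c0 + i) * k] and none reaches the next multiple, which is therefore
   the shift sought. *)
exists (c0 + i.+1%:Z).
have S1 : slab k%:R (j |: D) E (x + ((c0 + i.+1%:Z)%:~R * k%:R) *: u).
  apply/(slabU1 _ _ jD jE); exists ((c0 + i.+1%:Z)%:~R * k%:R - t); last first.
    by rewrite -addrA -scaleNr -scalerDl subKr.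
  have : t < (c0 + i.+1%:Z)%:~R * k%:R.
    by rewrite ltNge; apply/negP => /nJ.
  move: ht; rewrite -addn1 PoszD addrA [in X in _ -> X](rmorphD _ _ 1) /= mulrDl mul1r; lra.
split=> // [|c' h1 h2]; first exact: nJ.
case: (ltgtP c' (c0 + i.+1%:Z)) => // cc.
  by case: h2; apply: uniqC cc _ _.
by case: (nJ _ (lexx _)); apply: uniqC cc _ _.
Qed.
End Slabs.

(** * Lattice points of dilated zonotopes: Stanley's formula *)

Section Counting.
Variables (R : realType) (n m : nat) (v : 'I_m -> 'rV[int]_n).
Implicit Types (D E F : {set 'I_m}) (k : nat).

Let T k D E (z : 'rV[int]_n) := slab v k%:R D E (toR R z).
Let K k E := sublattice v k E.

Lemma sublatticeB k E x y : K k E x -> K k E y -> K k E (x - y).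
Proof.
move=> [c cE ->] [d dE ->]; exists (fun j => c j - d j).
  by move=> j jE; rewrite cE ?dE ?subrr.
by rewrite combzB scalerBr.
Qed.

Lemma sublatticeS k D E x : D \subset E -> K k D x -> K k E x.
Proof.
move=> /fintype.subsetP DE [c cD ->]; exists c => // j jE; apply: cD.
by apply: contra jE; apply: DE.
Qed.

Lemma sublattice0 k E : K k E 0.
Proof.
by exists (fun=> 0) => //; rewrite /combz big1 ?scaler0 // => j _; rewrite scale0r.
Qed.

Lemma sublatticeN k E x : K k E x -> K k E (- x).
Proof. by rewrite -sub0r; apply: sublatticeB; apply: sublattice0. Qed.

Lemma toR_sublattice k (c : 'I_m -> int) : toR R (k%:Z *: combz v c) = comb v (fun j => k%:R * (c j)%:~R).
Proof. by rewrite toRZ toR_combz combZ. Qed.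

Lemma slabK k D E z x : [disjoint D & E] -> K k E x -> T k D E z -> T k D E (z + x).
Proof.
move=> dDE [c cE ->]; rewrite /T toRD toR_sublattice => Tz; apply: slab_addE Tz => // j jE.
by rewrite cE ?mulr0.
Qed.

(** A deletion-contraction step. Points already in the slab of [D] and [E] are represented by [s1].
    For the others, [unique_shift] selects exactly one point in each class modulo [k v_j] of the
    slab extended along [v j], whence the shifted copy of [s2]. *)
Lemma transversal_add k D E j s1 s2 : (0 < k)%N -> j \notin D -> j \notin E ->
  [disjoint D & E] -> indep R v (j |: E) ->
  transversal (T k D E) (K k E) s1 ->
  transversal (T k D (j |: E)) (K k (j |: E)) s2 ->
  exists2 s, transversal (T k (j |: D) E) (K k E) s & size s = (size s1 + size s2)%N.
Proof.
move=> k0 jD jE dDE iE [s1T s1c s1i s1u] [s2T s2c s2i s2u].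
have EjE : E \subset j |: E by apply: finset.subsetUr.
have dDjE : [disjoint D & j |: E].
  rewrite disjoint_sym finset.disjoints_subset; apply/fintype.subsetP => i; rewrite !inE.
  case/orP => [/eqP ->//|iE']; move/pred0P: dDE => /(_ i) /=; rewrite iE' andbT => -> //.
have dDE' : [disjoint j |: D & E].
  rewrite finset.disjoints_subset; apply/fintype.subsetP => i; rewrite !inE.
  case/orP => [/eqP ->//|iD]; move/pred0P: dDE => /(_ i) /=; rewrite iD /= => -> //.
have T12 z : T k D E z -> T k (j |: D) E z.
  rewrite /T => h; apply/(slabU1 _ _ _ jD jE); exists 0; first by rewrite lexx ler0n.
  by rewrite scale0r subr0.
have T23 z : T k (j |: D) E z -> T k D (j |: E) z.
  rewrite /T => /(slabU1 _ _ _ jD jE)[r _ h]; apply/(slab_span _ _ _ jD jE); exists (- r).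
  by rewrite scaleNr.
pose mv (z : 'rV[int]_n) (c : int) : 'rV[int]_n := z + (c * k%:Z) *: v j.
have toRmv z c : toR R (mv z c) = toR R z + (c%:~R * k%:R) *: toR R (v j).
  by rewrite /mv toRD toRZ rmorphM.
have KmvB z c : K k (j |: E) (mv z c - z).
  exists (fun i => if i == j then c else 0).
    by move=> i; rewrite !inE negb_or => /andP[/negbTE ->].
  by rewrite combz1 /mv addrAC subrr add0r scalerA mulrC.
have exc z : exists c, T k D (j |: E) z ->
   [/\ T k (j |: D) E (mv z c), ~ T k D E (mv z c)
     & forall c', T k (j |: D) E (mv z c') -> ~ T k D E (mv z c') -> c' = c].
  have [Tz|nTz] := pselect (T k D (j |: E) z); last by exists 0.
  have [c [h1 h2 h3]] := unique_shift k0 jD jE iE Tz; exists c => _.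
  by rewrite /T !toRmv; split => // c'; rewrite !toRmv; apply: h3.
have [sc scP] := choice exc; pose sh z := mv z (sc z).
exists (s1 ++ map sh s2); last by rewrite size_cat size_map.
have shT z : z \in s2 -> T k (j |: D) E (sh z) by move=> /s2T /scP [].
have shN z : z \in s2 -> ~ T k D E (sh z) by move=> /s2T /scP [].
have shinj : {in s2 &, forall y z, K k E (sh y - sh z) -> y = z}.
  move=> y z ys zs h; apply: s2i => //.
  have -> : y - z = (sh y - sh z) - (sh y - y) + (sh z - z).
    by move: (sh y) (sh z) => y' z'; apply/rowP => i; rewrite !mxE; ring.
  rewrite -[X in _ + X]opprK; apply: sublatticeB; last exact/sublatticeN/KmvB.
  by apply: sublatticeB; [apply: sublatticeS h | apply: KmvB].
split.
- by move=> z; rewrite mem_cat => /orP[/s1T /T12|/mapP[y ys ->]] //; apply: shT.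
- move=> z Tz; have [T1z|nT1z] := pselect (T k D E z).
    by have [y ys h] := s1c z T1z; exists y => //; rewrite mem_cat ys.
  have [y ys [c cE Ec]] := s2c z (T23 z Tz).
  exists (sh y); first by rewrite mem_cat map_f ?orbT.
  (* The difference [z - y] splits into a shift by [c j] along [v j] and the part [x] in [k Z^E];
     uniqueness identifies [c j] with the chosen shift. *)
  pose x : 'rV[int]_n := k%:Z *: combz v (fun i => if i == j then 0 else c i).
  have Kx : K k E x.
    exists (fun i => if i == j then 0 else c i) => // i iE'.
    by case: eqVneq => // ij; apply: cE; rewrite !inE negb_or ij.
  have Ez : z = mv y (c j) + x.
    have -> : z = y + (z - y) by rewrite addrC subrK.
    rewrite Ec /mv -addrA; congr (_ + _).
    rewrite mulrC -scalerA -combz1 -scalerDr; congr (_ *: _).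
    rewrite /combz -big_split; apply: eq_bigr => i _ /=; rewrite -scalerDl.
    by case: eqVneq => [->|]; rewrite ?addr0 ?add0r.
  have Emv : mv y (c j) = z - x by rewrite Ez addrK.
  have -> : sh y = z - x.
    have [_ _ scu] := scP y (s2T y ys).
    rewrite /sh -(scu (c j)) Emv //; first by apply: slabK => //; apply: sublatticeN.
    by move=> h; apply: nT1z; rewrite -(subrK x z); apply: slabK.
  by rewrite opprB addrC subrK.
- move=> y z; rewrite !mem_cat => /orP[ys|/mapP[y' ys ->]] /orP[zs|/mapP[z' zs ->]] h.
  + exact: s1i.
  + case: (shN z' zs); rewrite -(subrK y (sh z')) -opprB addrC; apply: slabK => //.
      exact: sublatticeN.
    exact: s1T.
  + case: (shN y' ys); rewrite -(subrK z (sh y')) addrC; apply: slabK => //.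
    exact: s1T.
  + by rewrite (shinj y' z').
- rewrite cat_uniq s1u /=; apply/andP; split.
    by apply/hasPn => _ /mapP[z zs ->]; apply/negP => /s1T; apply: shN.
  rewrite map_inj_in_uniq // => y z ys zs h; apply: shinj => //.
  by rewrite h subrr; apply: sublattice0.
Qed.

(** The span of [E] contains [v j] and absorbs the new segment. *)
Lemma slab_dep k D E j : j \notin D -> j \notin E -> [disjoint D & E] ->
  indep R v E -> ~ indep R v (j |: E) -> T k (j |: D) E = T k D E.
Proof.
move=> jD jE dDE iE /(indep_dep iE)[t tE vj].
apply/funext => z; apply/propext; rewrite /T; split.
  move=> /(slabU1 _ _ _ jD jE)[s _ h].
  rewrite -(subrK (s *: toR R (v j)) (toR R z)) vj -combZ.
  apply: slab_addE => // [i iE'|]; first by rewrite tE ?mulr0.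
  by rewrite combZ -vj.
move=> h; apply/(slabU1 _ _ _ jD jE); exists 0; first by rewrite lexx ler0n.
by rewrite scale0r subr0.
Qed.

(** Subtracting integer parts of the coefficients reaches the half-open parallelepiped; its lattice
    points are finitely many, all coordinates being at most [B] in absolute value. *)
Lemma transversal_parallelepiped E : indep R v E ->
  exists s, transversal (T 1 finset.set0 E) (K 1 E) s.
Proof.
move=> iE.
pose P (z : 'rV[int]_n) := `[< exists t, [/\ toR R z = comb v t,
  forall j, 0 <= t j < 1 & forall j, j \notin E -> t j = 0] >].
pose B : nat := (\sum_j \sum_i absz (v j ord0 i))%N.
pose emb (X : {ffun 'I_n -> 'I_(B + B).+1}) : 'rV[int]_n := \row_i ((X i : nat)%:Z - B%:Z).
have PB z : P z -> exists X, z = emb X.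
  move=> /asboolP[t [Ez t01 tE]].
  have zB i : `|z ord0 i| <= B%:Z.
    rewrite -(ler_int R) intr_norm.
    have -> : (z ord0 i)%:~R = (comb v t) ord0 i by rewrite -Ez mxE.
    rewrite /comb summxE (le_trans (ler_norm_sum _ _ _)) // -[(B%:Z)%:~R]/(B%:R) /B natr_sum.
    apply: ler_sum => j _; rewrite !mxE normrM -intr_norm -abszE.
    have /andP[t0 t1] := t01 j.
    rewrite (ger0_norm t0) -[(Posz _)%:~R]/((absz (v j ord0 i))%:R).
    apply: (@le_trans _ _ (1 * (absz (v j ord0 i))%:R)); first by rewrite ler_wpM2r // ltW.
    by rewrite mul1r ler_nat (bigD1 i) //= leq_addr.
  exists [ffun i => inord (absz (z ord0 i + B%:Z))]; apply/rowP => i.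
  have := zB i; rewrite !mxE ffunE => h.
  rewrite inordK; last by move: h; move: (z ord0 i) => a; lia.
  by move: h; move: (z ord0 i) => a; lia.
exists (undup [seq z <- [seq emb X | X <- enum {: {ffun 'I_n -> 'I_(B + B).+1}}] | P z]).
split.
- move=> z; rewrite mem_undup mem_filter => /andP[/asboolP[t [Ez t01 tE]] _].
  by exists t; split=> // j; rewrite !inE // => /tE.
- move=> z [t [Ez _ t0]].
  have tE j : j \notin E -> t j = 0 by move=> jE; apply: t0; rewrite !inE.
  pose c j := Num.floor (t j).
  have Ky : K 1 E (z - (z - combz v c)).
    exists c; first by move=> j /tE; rewrite /c => ->; rewrite floor0.
    by rewrite subKr scale1r.
  exists (z - combz v c) => //.
  have Py : P (z - combz v c).
    apply/asboolP; exists (fun j => t j + - (c j)%:~R); split.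
    + by rewrite toRB toR_combz Ez combD combN.
    + move=> j; have /andP[h1 h2] := floor_itv (t j); rewrite -/(c j) in h1 h2.
      by move: h2; rewrite rmorphD /=; lra.
    + by move=> j /tE; rewrite /c => ->; rewrite floor0 subrr.
  rewrite mem_undup mem_filter Py /=; have [X ->] := PB _ Py.
  by apply: map_f; rewrite mem_enum.
- move=> y z; rewrite !mem_undup !mem_filter.
  move=> /andP[/asboolP[t [Ey t01 tE]] _] /andP[/asboolP[u [Ez u01 uE]] _] [c cE Ec].
  have h0 j : j \notin E -> t j + - u j + - (c j)%:~R = 0.
    by move=> jE; rewrite tE ?uE ?cE // subrr subr0.
  have h : forall j, t j + - u j + - (c j)%:~R = 0.
    apply: (iE (fun j => t j + - u j + - (c j)%:~R) h0).
    rewrite !combD !combN -Ey -Ez -toR_combz -toRB Ec scale1r subrr //.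
  have tu j : t j = u j.
    have := h j; have /andP[h1 h2] := t01 j; have /andP[h3 h4] := u01 j.
    have [->|c0] := eqVneq (c j) 0; first by lra.
    have : 1 <= `|(c j)%:~R| :> R by rewrite -intr_norm (ler_int R 1); lia.
    by case: ger0P => ?; lra.
  by apply: (@toR_inj R); rewrite Ey Ez; apply: eq_bigr => j _; rewrite tu.
- exact: undup_uniq.
Qed.

(** To each representative modulo [Z^E] are added the combinations of the [v j], [j \in E], with
    digits in [[0, k)], which represent [Z^E] modulo [k Z^E]. *)
Lemma transversal_dilate k E s : (0 < k)%N -> indep R v E ->
  transversal (T 1 finset.set0 E) (K 1 E) s ->
  exists2 s', transversal (T k finset.set0 E) (K k E) s' & size s' = (k ^ #|E| * size s)%N.
Proof.
case: k => // k _ iE [sT sc si su].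
have comb0 c : (forall j, j \notin E -> c j = 0) -> combz v c = 0 -> forall j, c j = 0.
  move=> cE c0 j; apply: (@intr_inj R); apply: (iE (fun j => (c j)%:~R)).
    by move=> i iE'; rewrite cE.
  by rewrite -toR_combz c0 toR0.
pose A := enum (pffun_on ord0 E (fun _ : 'I_k.+1 => true)).
have AE (r : {ffun 'I_m -> 'I_k.+1}) : r \in A -> forall j, j \notin E -> r j = ord0.
  rewrite mem_enum => /pffun_onP[/fintype.subsetP h _] j jE; apply/eqP/negPn/negP => rj.
  by move: jE; rewrite (h j).
pose rz (r : {ffun 'I_m -> 'I_k.+1}) := combz v (fun j => (r j : nat)%:Z).
pose f (y : 'rV[int]_n) r := y + rz r.
have dT k' z : T k' finset.set0 E z <-> exists2 t, toR R z = comb v t & forall j, j \notin E -> t j = 0.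
  split=> [[t [h1 h2 h3]]|[t h1 h3]].
    by exists t => // j jE; apply: h3; rewrite !inE.
  by exists t; split=> // j; rewrite !inE // => /h3.
have finj y y' r r' : y \in s -> y' \in s -> r \in A -> r' \in A ->
    K k.+1 E (f y r - f y' r') -> y = y' /\ r = r'.
  move=> ys ys' rA rA' [c cE Ec].
  pose d j := k.+1%:Z * c j - (r j : nat)%:Z + (r' j : nat)%:Z.
  have dE j : j \notin E -> d j = 0 by move=> jE; rewrite /d cE // (AE r) // (AE r') // mulr0.
  have Ed : y - y' = combz v d.
    have -> : y - y' = k.+1%:Z *: combz v c - (rz r - rz r').
      by rewrite -Ec /f opprD addrACA addrK.
    rewrite /rz /combz scaler_sumr -!sumrB; apply: eq_bigr => j _.
    by rewrite -scalerBl scalerA -scalerBl /d opprB addrCA addrC.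
  have yy : y = y' by apply: si => //; exists d => //; rewrite scale1r.
  split=> //; apply/ffunP => j; apply/val_inj => /=.
  have := comb0 d dE; rewrite -Ed yy subrr => /(_ erefl j).
  rewrite /d; move: (ltn_ord (r j)) (ltn_ord (r' j)).
  by move: (nat_of_ord (r j)) (nat_of_ord (r' j)) (c j) => a b e; case: (ltgtP e 0) => he; nia.
exists [seq f y r | y <- s, r <- A]; last first.
  by rewrite size_allpairs mulnC /A -cardE card_pffun_on card_ord.
split.
- move=> z /allpairsP[[y r] [/= ys rA ->]].
  have /dT[t Et tE] := sT y ys; apply/dT.
  exists (fun j => t j + ((r j : nat)%:Z)%:~R); first by rewrite toRD Et toR_combz combD.
  by move=> j jE; rewrite tE // (AE r) // addr0.
- move=> z /dT[t Et tE].
  have [|y ys [c cE Ec]] := sc z; first by apply/dT; exists t.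
  pose r : {ffun 'I_m -> 'I_k.+1} := [ffun j => inord (absz (c j %% k.+1%:Z)%Z)].
  have rE j : (r j : nat)%:Z = (c j %% k.+1%:Z)%Z.
    have h1 := @modz_ge0 (c j) k.+1%:Z isT; have h2 := @ltz_pmod (c j) k.+1%:Z isT.
    by rewrite ffunE inordK; move: h1 h2; move: (_ %% _)%Z => a; lia.
  exists (f y r).
    apply/allpairsP; exists (y, r); split=> //=; rewrite mem_enum; apply/pffun_onP; split=> //.
    apply/fintype.subsetP => j; rewrite inE; apply: contraR => jE.
    by apply/eqP/val_inj/eqP; rewrite /= -eqz_nat rE cE // mod0z.
  exists (fun j => (c j %/ k.+1%:Z)%Z); first by move=> j jE; rewrite cE // div0z.
  rewrite /f opprD addrA Ec scale1r /rz /combz scaler_sumr -sumrB; apply: eq_bigr => j _.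
  by rewrite rE -scalerBl scalerA {1}(divz_eq (c j) k.+1%:Z) addrK mulrC.
- move=> _ _ /allpairsP[[y r] [/= ys rA ->]] /allpairsP[[y' r'] [/= ys' rA' ->]] h.
  by have [-> ->] := finj _ _ _ _ ys ys' rA rA' h.
- apply: allpairs_uniq => //; first exact: enum_uniq.
  move=> _ _ /allpairsP[[y r] [/= ys rA ->]] /allpairsP[[y' r'] [/= ys' rA' ->]] /= h.
  have [] := finj _ _ _ _ ys ys' rA rA'; last by move=> -> ->.
  by rewrite h subrr; apply: sublattice0.
Qed.

(** The size of [s E] is the index [g E]. By induction on [D], the count for a slab is a sum over
    the independent [F] between [E] and [E :|: D]; [transversal_add] splits it according to whether
    [F] contains [j]. *)
Lemma transversal_count : exists s : {set 'I_m} -> seq 'rV[int]_n,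
  (forall E, indep R v E -> transversal (T 1 finset.set0 E) (K 1 E) (s E)) /\
  forall k N, (0 < k)%N -> lattice_card (dilate k%:R (zonotope v : classical_sets.set 'rV[R]_n)) N ->
    N = (\sum_(E | `[< indep R v E >]) k ^ #|E| * size (s E))%N.
Proof.
have [s sP] : exists s : {set 'I_m} -> seq 'rV[int]_n,
    forall E, indep R v E -> transversal (T 1 finset.set0 E) (K 1 E) (s E).
  have ex E : exists s, indep R v E -> transversal (T 1 finset.set0 E) (K 1 E) s.
    have [iE|nE] := pselect (indep R v E); last by exists [::].
    by have [s h] := transversal_parallelepiped iE; exists s.
  by have [s sP] := choice ex; exists s.
exists s; split=> // k N k0 [l [lu [lP <-]]].
have main (d : seq 'I_m) : uniq d -> forall E, indep R v E -> [disjoint [set j in d] & E] ->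
  exists2 s', transversal (T k [set j in d] E) (K k E) s'
    & size s' = (\sum_(F | `[< indep R v F >] && (E \subset F) && (F \subset E :|: [set j in d]))
        k ^ #|F| * size (s F))%N.
  elim: d => [|j d IH] /=.
    move=> _ E iE _.
    have [s' h1 h2] := transversal_dilate k0 iE (sP E iE).
    have E0 : [set j in [::]] = finset.set0 :> {set 'I_m} by apply/setP => j; rewrite !inE.
    exists s'; rewrite E0 // h2 finset.setU0 (big_pred1 E) // => F /=.
    rewrite -andbA -finset.eqEsubset eq_sym andb_idl // => /eqP ->.
    exact/asboolP.
  case/andP=> jd du E iE; rewrite set_cons => dis.
  have jD : j \notin [set i in d] by rewrite inE.
  have jE : j \notin E.
    by move/pred0P: dis => /(_ j) /=; rewrite !inE eqxx /= => ->.
  have dis' : [disjoint [set i in d] & E].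
    apply/pred0P => i /=; move/pred0P: dis => /(_ i) /=; rewrite !inE.
    by case: (i \in E); rewrite ?andbF // !andbT => /negbT; rewrite negb_or => /andP[_ /negbTE].
  have [s1 h1 e1] := IH du E iE dis'.
  have split_sum : (\sum_(F | `[< indep R v F >] && (E \subset F) && (F \subset E :|: (j |: [set i in d])))
        k ^ #|F| * size (s F) =
     \sum_(F | `[< indep R v F >] && (E \subset F) && (F \subset E :|: [set i in d])) k ^ #|F| * size (s F) +
     \sum_(F | `[< indep R v F >] && (j |: E \subset F) && (F \subset (j |: E) :|: [set i in d]))
        k ^ #|F| * size (s F))%N.
    rewrite (bigID (fun F : {set 'I_m} => j \in F)) [LHS]addnC /=; congr (_ + _)%N; apply: eq_bigl => F.
      rewrite finset.setUCA -[LHS]andbA; congr (_ && _).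
      apply/andP/idP => [[FE jF]|FE].
        apply/fintype.subsetP => i iF; have := fintype.subsetP FE i iF; rewrite !inE.
        by case: eqVneq iF jF => [->->|].
      split; first by apply: fintype.subset_trans FE _; apply: finset.subsetUr.
      by apply: contra jE => /(fintype.subsetP FE); rewrite !inE (negbTE jd) orbF.
    rewrite finset.setUCA finset.setUA finset.subUset finset.sub1set.
    by case: (j \in F); case: (E \subset F); case: `[< indep R v F >]; rewrite /= ?andbT ?andbF.
  rewrite split_sum; have [iEj|nEj] := pselect (indep R v (j |: E)).
    have dis2 : [disjoint [set i in d] & j |: E].
      apply/pred0P => i /=; move/pred0P: dis' => /(_ i) /=; rewrite !inE.
      by case: eqVneq => [->|_ //]; rewrite (negbTE jd).
    have [s2 h2 e2] := IH du (j |: E) iEj dis2.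
    have [s' h' e'] := transversal_add k0 jD jE dis' iEj h1 h2.
    by exists s' => //; rewrite e' e1 e2.
  (* No independent [F] contains the dependent set [j |: E], so the second sum is empty. *)
  exists s1; first by rewrite (slab_dep _ jD jE).
  rewrite e1 [X in (_ + X)%N]big1 ?addn0 // => F /andP[/andP[/asboolP iF jF] _].
  by case: nEj; apply: indepW iF.
have i0 : indep R v finset.set0.
  by move=> t t0 _ j; apply: t0; rewrite inE.
have dis0 : [disjoint [set j in enum 'I_m] & (finset.set0 : {set 'I_m})].
  by apply/pred0P => j /=; rewrite !inE andbF.
have [s' [s'T s'c s'i s'u] <-] : exists2 s', transversal (T k [set j in enum 'I_m] finset.set0) (K k finset.set0) s'
   & size s' = (\sum_(E | `[< indep R v E >]) k ^ #|E| * size (s E))%N.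
  have [s' h e] := main (enum 'I_m) (enum_uniq _) finset.set0 i0 dis0.
  exists s' => //; rewrite e; apply: eq_bigl => F; rewrite finset.sub0set andbT andb_idr // => _.
  by apply/fintype.subsetP => j _; rewrite !inE mem_enum.
apply/perm_size/uniq_perm => // z.
have kR : k%:R != 0 :> R by rewrite pnatr_eq0 -lt0n.
have TZ : T k [set j in enum 'I_m] finset.set0 z <-> dilate k%:R (zonotope v) (toR R z).
  split=> [[t [Ez tD _]]|[y [[t [t01 ->]] Ez]]].
    exists (k%:R^-1 *: toR R z); split; last by rewrite scalerA divff // scale1r.
    exists (fun j => k%:R^-1 * t j); split; last by rewrite Ez -combZ.
    move=> j; have /andP[h1 h2] : 0 <= t j <= k%:R by apply: tD; rewrite !inE mem_enum.
    by rewrite mulr_ge0 ?invr_ge0 // mulrC ler_pdivrMr ?mul1r ?ltr0n.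
  exists (fun j => k%:R * t j); split; first by rewrite Ez combZ.
    move=> j _; have /andP[h1 h2] := t01 j; rewrite mulr_ge0 //=.
    by rewrite -[X in _ <= X]mulr1 ler_wpM2l.
  by move=> j; rewrite !inE mem_enum.
apply/idP/idP => [/lP /TZ Tz|zs]; last by apply/lP/TZ/s'T.
(* The sublattice of the empty set is zero, so each point is its own representative. *)
have [y ys [c c0 Ec]] := s'c z Tz.
suff -> : z = y by [].
apply/eqP; rewrite -subr_eq0 Ec /combz big1 ?scaler0 // => j _.
by rewrite c0 ?scale0r // inE.
Qed.
End Counting.

(** * Integer linear forms vanishing on short lattice points *)

Lemma row_free_rowsub (F : fieldType) m n p (A : 'M[F]_(m, n)) (f : 'I_p -> 'I_m) :
  injective f -> row_free A -> row_free (rowsub f A).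
Proof.
move=> finj /row_freeP[B AB]; apply/row_freeP; exists (B *m (rowsub f 1%:M)^T).
rewrite mulmxA mul_rowsub_mx AB -rowsubE; apply/matrixP => i j.
by rewrite !mxE (inj_eq finj) eq_sym.
Qed.

Lemma scaled_integral (I : finType) (g : I -> rat) :
  exists c : int, c != 0 /\ exists f : I -> int, forall i, (f i)%:~R = c%:~R * g i.
Proof.
exists (\prod_i denq (g i)); split.
  by apply/prodf_neq0 => i _; apply: denq_neq0.
exists (fun i => numq (g i) * \prod_(j | j != i) denq (g j)) => i.
by rewrite [in RHS](bigD1 i) //= !intrM numqE; ring.
Qed.

Section Functionals.
Variables (R : realType) (n : nat).
Implicit Types (W : 'rV[int]_n -> Prop).

(** Ranks are taken over the rationals so that a form killing the subspace can be scaled to integer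
    coefficients. *)
Let toQ p q (A : 'M[int]_(p, q)) : 'M[rat]_(p, q) := map_mx intr A.

Let ratr_toQ p (y : 'I_p -> 'rV[int]_n) :
  \matrix_(j < p) toR R (y j) = map_mx ratr (\matrix_(j < p) toQ (y j)).
Proof. by apply/matrixP => i j; rewrite !mxE ratr_int. Qed.

(* A maximal-rank family from [W] has rank at most [k], so with [y] it spans a proper subspace. *)
Lemma killing_functional k d W (y : 'I_d -> 'rV[int]_n) : (k + d < n)%N ->
  (forall p : 'I_k.+1 -> 'rV[int]_n, (forall j, W (p j)) ->
     ~ row_free (\matrix_(j < k.+1) toR R (p j))) ->
  exists f : 'cV[int]_n,
    [/\ f != 0, forall w, W w -> w *m f = 0 & forall j, y j *m f = 0].
Proof.
move=> kdn Wk.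
pose P r := `[< exists N (p : 'I_N -> 'rV[int]_n), (forall j, W (p j)) /\
   \rank (\matrix_(j < N) toQ (p j)) = r >].
have exP : exists r, P r.
  exists 0%N; apply/asboolP; exists 0%N, (fun=> 0); split; first by case.
  by apply/eqP; rewrite -leqn0 rank_leq_row.
have ubP r : P r -> (r <= n)%N by move=> /asboolP[N [p [_ <-]]]; apply: rank_leq_col.
case: (ex_maxnP exP ubP) => r /asboolP[N [p [Wp rp]]] rmax {exP ubP}.
set B := \matrix_(j < N) toQ (p j) in rp.
have rk : (r <= k)%N.
  rewrite leqNgt; apply/negP => kr.
  have kr' : (k < \rank B)%N by rewrite rp.
  pose h (j : 'I_k.+1) := maxrankfun B (widen_ord kr' j).
  apply: (Wk (fun j => p (h j))) => [j|]; first exact: Wp.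
  rewrite (ratr_toQ (fun j => p (h j))) row_free_map.
  have -> : \matrix_(j < k.+1) toQ (p (h j)) = rowsub (widen_ord kr') (rowsub (maxrankfun B) B).
    by apply/matrixP => i j; rewrite !mxE.
  apply: row_free_rowsub (maxrowsub_free B) => i j /(congr1 val) /= ij.
  exact: val_inj.
(* Appending [w] to the family cannot raise its maximal rank. *)
have WB w : W w -> (toQ w <= B)%MS.
  move=> Ww; pose p' (j : 'I_(N + 1)) := if split j is inl i then p i else w.
  have E : \matrix_(j < N + 1) toQ (p' j) = col_mx B (toQ w).
    apply/matrixP => i j; rewrite !mxE /p'.
    by case: split => a; rewrite !mxE // ord1.
  have : P (\rank (col_mx B (toQ w))).
    apply/asboolP; exists (N + 1)%N, p'; rewrite E; split=> // j.
    by rewrite /p'; case: split.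
  move/rmax; rewrite -addsmxE -rp => h.
  have := mxrank_leqif_sup (addsmxSl B (toQ w)) => -[h1 h2].
  have : (B + toQ w <= B)%MS by rewrite -h2 eqn_leq h1 h.
  by rewrite addsmx_sub => /andP[].
pose Y := \matrix_(j < d) toQ (y j).
have : cokermx (B + Y)%MS != 0.
  rewrite cokermx_eq0 /row_full neq_ltn; apply/orP; left.
  apply: leq_ltn_trans (mxrank_adds_leqif B Y) _; apply: leq_ltn_trans kdn.
  by rewrite rp leq_add // rank_leq_row.
move=> /matrix0Pn[a [l nz]].
set g := col l (cokermx (B + Y)%MS).
have gk x : (x <= B + Y)%MS -> x *m g = 0 :> 'M[rat]_1.
  by rewrite submxE => /eqP h; rewrite /g colE mulmxA h mul0mx.
have [c [c0 [f fE]]] := scaled_integral (fun i => g i ord0).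
have Ef : toQ (\col_i f i) = c%:~R *: g.
  by apply/colP => i; rewrite mxE [in LHS]mxE fE [in RHS]mxE.
have c0' : c%:~R != 0 :> rat by rewrite intr_eq0.
have kill w : (toQ w <= B + Y)%MS -> w *m (\col_i f i) = 0 :> 'M[int]_1.
  move=> /gk h; have : toQ (w *m (\col_i f i)) = 0.
    by rewrite /toQ map_mxM -/(toQ _) -/(toQ _) Ef -scalemxAr h scaler0.
  move=> /matrixP E; apply/matrixP => i j; apply: (@intr_inj rat).
  by have := E i j; rewrite [in LHS]mxE => ->; rewrite !mxE.
exists (\col_i f i); split.
- apply: contraNneq nz => f0; have := congr1 (fun M => toQ M a 0) f0.
  rewrite Ef !mxE rmorph0 => /eqP; rewrite mulf_eq0 (negbTE c0') /=.
  by [].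
- by move=> w /WB h; apply: kill; apply: submx_trans h (addsmxSl _ _).
- move=> j; apply: kill; apply: submx_trans (addsmxSr _ _).
  by have := row_sub j Y; rewrite rowK.
Qed.

(* The forms are chosen from the last index down; each pivot [pi k] is any [y] on which the
   new form does not vanish, hence automatically new. *)
Lemma triangular_functionals (y : 'I_n -> 'rV[int]_n) (W : 'I_n -> 'rV[int]_n -> Prop) :
  row_free (\matrix_(j < n) toR R (y j)) ->
  (forall (k : 'I_n) (p : 'I_k.+1 -> 'rV[int]_n), (forall j, W k (p j)) ->
     ~ row_free (\matrix_(j < k.+1) toR R (p j))) ->
  exists (pi : 'I_n -> 'I_n) (f : 'I_n -> 'cV[int]_n),
    [/\ injective pi, forall k w, W k w -> w *m f k = 0,
      forall k j : 'I_n, (k < j)%N -> y (pi j) *m f k = 0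
    & forall k, y (pi k) *m f k != 0].
Proof.
move=> yfree WP.
have step (d : nat) : (d <= n)%N -> exists (pi : 'I_n -> 'I_n) (f : 'I_n -> 'cV[int]_n),
    forall k : 'I_n, (n - d <= k)%N ->
    [/\ forall w, W k w -> w *m f k = 0,
      forall j : 'I_n, (k < j)%N -> y (pi j) *m f k = 0 & y (pi k) *m f k != 0].
  elim: d => [_|d IH dn].
    exists id, (fun=> 0) => k; by rewrite subn0 leqNgt ltn_ord.
  have [pi [f pf]] := IH (ltnW dn).
  have kn : (n - d.+1 < n)%N by rewrite ltn_subrL; case: (n) dn.
  pose k := Ordinal kn.
  have jn (j : 'I_d) : (n - d + j < n)%N by have := ltn_ord j; lia.
  have kd : (k + d < n)%N by rewrite /k /=; lia.
  have [g [g0 gW gy]] := killing_functional (fun j => y (pi (Ordinal (jn j)))) kd (WP k).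
  (* The [y j] form a basis, so the nonzero form [g] cannot vanish on all of them. *)
  have [i yi] : exists i, y i *m g != 0.
    apply/existsP; apply: contraNT g0; rewrite negb_exists => /forallP h.
    have : (\matrix_(j < n) toR R (y j)) *m map_mx intr g = (\matrix_(j < n) toR R (y j)) *m 0.
      apply/row_matrixP => j; rewrite mulmx0 row0 row_mul rowK -map_mxM.
      by have := h j; rewrite negbK => /eqP ->; rewrite map_mx0.
    have full : row_full (\matrix_(j < n) toR R (y j)) by [].
    move=> /(row_full_inj full) /matrixP E; apply/eqP/matrixP => a b.
    by apply: (@intr_inj R); have := E a b; rewrite !mxE.
  exists (fun j => if j == k then i else pi j), (fun j => if j == k then g else f j) => l kl.
  have [->|lk] := eqVneq l k.
    split=> // j kj; case: eqVneq => [jk|_]; first by rewrite jk ltnn in kj.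
    have jd : (j - (n - d) < d)%N by have := ltn_ord j; move: kj; rewrite /k /=; lia.
    rewrite -(gy (Ordinal jd)); congr (y (pi _) *m _); apply: val_inj => /=.
    by move: kj; rewrite /k /=; lia.
  have kl' : (n - d <= l)%N.
    have : (l : nat) != k by []. 
    by move: kl; rewrite /k /=; lia.
  have [h1 h2 h3] := pf l kl'; split=> // j lj; case: eqVneq => [jk|_]; last exact: h2.
  by move: lj kl'; rewrite jk /k /=; lia.
have [pi [f h]] := step n (leqnn n).
rewrite subnn in h.
exists pi, f; split; try by move=> k; have [] := h k (leq0n k).
move=> i j ij; apply/eqP; apply: contraT; rewrite neq_ltn => /orP[lt|lt].
  by have [_ /(_ j lt)] := h i (leq0n i); rewrite -ij => -> /eqP.
by have [_ /(_ i lt)] := h j (leq0n j); rewrite ij => -> /eqP.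
Qed.
End Functionals.

(** * Bounding the indices inside one basis of generators *)

Lemma sum_spread (S : pzRingType) (V : lmodType S) e m (h : 'I_e -> 'I_m) (x : 'I_e -> S) (w : 'I_m -> V) :
  \sum_j (\sum_(s | h s == j) x s) *: w j = \sum_s x s *: w (h s).
Proof.
rewrite [RHS](partition_big h xpredT) //=; apply: eq_bigr => j _.
by rewrite scaler_suml; apply: eq_bigr => s /eqP ->.
Qed.

Lemma sum_fiber_inj (V : nmodType) e m (h : 'I_e -> 'I_m) (x : 'I_e -> V) s :
  injective h -> \sum_(t | h t == h s) x t = x s.
Proof. by move=> hinj; rewrite (big_pred1 s) // => t; rewrite (inj_eq hinj). Qed.

Lemma enum_val_ord_lt n (I : {set 'I_n}) (i j : 'I_#|I|) :
  (i < j)%N -> (enum_val i < enum_val j)%N.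
Proof.
move=> ij; pose x0 := enum_val i; rewrite !(enum_val_nth x0).
have tr : transitive (relpre (@nat_of_ord n) ltn) by move=> a b c /=; apply: ltn_trans.
have so : sorted (relpre (@nat_of_ord n) ltn) (enum I).
  rewrite {1}/enum_mem -enumT; apply: sorted_filter tr _ _ _.
  by rewrite -sorted_map val_enum_ord iota_ltn_sorted.
by apply: (sorted_ltn_nth tr x0 so) => //; rewrite inE -cardE ltn_ord.
Qed.

Section Parallelepiped.
Variables (R : realType) (n m : nat) (v : 'I_m -> 'rV[int]_n).
Variables (M : nat) (b : 'I_n -> nat) (h0 : 'I_n -> 'I_m) (s : {set 'I_m} -> seq 'rV[int]_n).
Hypothesis gp : general_position R v.
Hypothesis h0_inj : injective h0.
Hypothesis M_gt0 : (0 < M)%N.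
Hypothesis b_gt0 : forall k, (0 < b k)%N.
Hypothesis b_mono : forall i j : 'I_n, (i <= j)%N -> (b i <= b j)%N.

(** Lattice points of [DZ] dilated by [b k / M], a rational to be taken just below the minimum of
    index [k.+1]. *)
Let W (k : 'I_n) (z : 'rV[int]_n) :=
  exists2 t, toR R z = comb v t & forall j, `|t j| <= (b k)%:R / M%:R.

Hypothesis W_dim : forall (k : 'I_n) (p : 'I_k.+1 -> 'rV[int]_n),
  (forall j, W k (p j)) -> ~ row_free (\matrix_(j < k.+1) toR R (p j)).
Hypothesis sP : forall E, indep R v E ->
  transversal (fun z => slab v 1%:R finset.set0 E (toR R z)) (sublattice v 1 E) (s E).

Let Y (h : 'I_n -> 'I_m) : 'M[int]_n := \matrix_(j < n) v (h j).

Let toR_Y h : map_mx intr (Y h) = \matrix_(j < n) toR R (v (h j)).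
Proof. by apply/matrixP => i j; rewrite !mxE. Qed.

Let detY h : injective h -> \det (Y h) != 0.
Proof.
move=> /gp; rewrite -toR_Y row_free_unit unitmxE det_map_mx unitfE.
by apply: contraNneq => ->.
Qed.

Let comb_image h t : injective h -> (forall j, j \notin [set h i | i : 'I_n] -> t j = 0) ->
  comb v t = (\row_i t (h i)) *m (\matrix_(j < n) toR R (v (h j))).
Proof.
move=> hinj th; rewrite mulmx_sum_row /comb (bigID (mem [set h i | i : 'I_n])) /=.
rewrite [X in _ + X]big1 ?addr0 => [|j jh]; last by rewrite th ?scale0r.
rewrite big_imset /=; last by move=> i j _ _; apply: hinj.
by apply: eq_big => [i|i _]; rewrite ?inE // mxE rowK.
Qed.

Lemma indep_image h (I : {set 'I_n}) : injective h -> indep R v (h @: I).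
Proof.
move=> hinj t tE t0.
have {}tE k : k \notin [set h i | i : 'I_n] -> t k = 0.
  by move=> kh; apply: tE; apply: contra kh => /imsetP[i _ ->]; apply: imset_f.
have := gp hinj => /row_freeP[B YB].
have : (\row_i t (h i)) *m (\matrix_(j < n) toR R (v (h j))) = 0.
  by rewrite -(comb_image hinj tE).
move=> /(congr1 (mulmx^~ B)); rewrite mul0mx -mulmxA YB mulmx1 => /rowP E j.
have [/imsetP[i _ ->]|/tE //] := boolP (j \in [set h i | i : 'I_n]).
by have := E i; rewrite !mxE.
Qed.

(** By Cramer's rule, [z *m \adj (Y h)] is [\det (Y h)] times the coordinate vector of [z] in the
    basis [v (h j)]. *)
Lemma adj_coord_image h (I : {set 'I_n}) (z : 'rV[int]_n) t k :
  injective h -> toR R z = comb v t -> (forall j, j \notin h @: I -> t j = 0) ->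
  k \notin I -> (z *m \adj (Y h)) 0 k = 0.
Proof.
move=> hinj Ez tI kI.
have Ez' : map_mx intr z = (\row_i t (h i)) *m map_mx intr (Y h).
  rewrite -[LHS]/(toR R z) Ez toR_Y; apply: (comb_image hinj) => j jh.
  by rewrite tI //; apply: contra jh => /imsetP[i _ ->]; apply: imset_f.
apply: (@intr_inj R).
have -> : ((z *m \adj (Y h)) 0 k)%:~R = (map_mx intr (z *m \adj (Y h))) 0 k :> R.
  by rewrite [RHS]mxE.
rewrite map_mxM Ez' -mulmxA -map_mxM mul_mx_adj map_scalar_mx mul_mx_scalar !mxE.
by rewrite tI ?mulr0 // mem_imset.
Qed.

(** The cube theorem in the coordinates attached to [I], the flag being cut out by the triangular
    forms [f]. The ordering [pi] is the same for all [I], which makes summation over [I]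
    possible. *)
Lemma parallelepiped_bound :
  exists2 pi : 'I_n -> 'I_n, injective pi
    & forall I : {set 'I_n},
        (size (s ((h0 \o pi) @: I)) * \prod_(k in I) b k <= M ^ #|I|)%N.
Proof.
have [pi [f [pi_inj fW fup fdiag]]] := triangular_functionals (gp h0_inj) W_dim.
exists pi => // I; pose h := h0 \o pi.
have hinj : injective h by apply: inj_comp.
set E := _ @: I; pose e := #|I|.
have iE : indep R v E by apply: indep_image.
have [sT sc si su] := sP iE.
pose ks (i : 'I_e) : 'I_n := enum_val i.
have ksI i : ks i \in I by apply: enum_valP.
pose hs i := h (ks i).
have hs_inj : injective hs by move=> i j /hinj /enum_val_inj.
have hsE i : hs i \in E by apply: imset_f.
have ks_lt (i j : 'I_e) : (i < j)%N -> (ks i < ks j)%N.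
  exact: enum_val_ord_lt.
have ks_le (i j : 'I_e) : (i <= j)%N -> (ks i <= ks j)%N.
  by rewrite leq_eqVlt => /orP[/eqP/val_inj ->//|/ks_lt/ltnW].
pose A : 'M[int]_e := \matrix_(i, j) (v (hs i) *m f (ks j)) 0 0.
have dA : \det A != 0.
  rewrite -det_tr det_trig.
    apply/prodf_neq0 => i _; rewrite mxE [A _ _]mxE; apply: contra (fdiag (ks i)) => /eqP z0.
    by apply/eqP/matrixP => x y; rewrite !ord1 [LHS]z0 mxE.
  by apply/is_trig_mxP => i j ij; rewrite mxE [A _ _]mxE fup ?[LHS]mxE // ks_lt.
have xA (x : 'rV[int]_e) t : (x *m A) 0 t = ((\sum_i x 0 i *: v (hs i)) *m f (ks t)) 0 0.
  rewrite mxE mulmx_suml summxE; apply: eq_bigr => i _.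
  by rewrite -scalemxAl [RHS]mxE mxE.
pose D := \det (Y h); have D0 : D != 0 by apply: detY.
(* Coordinates of lattice points have denominators dividing [D]; the square clears them without a
   sign and cancels at the end. *)
pose D2 := (absz D ^ 2)%N; have D2_gt0 : (0 < D2)%N by rewrite expn_gt0 absz_gt0 D0.
have D2E : D2%:Z = D * D by rewrite /D2 -mulnn PoszM !abszE -normrM ger0_norm // -expr2 sqr_ge0.
pose q := (M * D2)%N; have q0 : (0 < q)%N by rewrite muln_gt0 M_gt0.
pose a (i : 'I_e) := (b (ks i) * D2)%N.
(* [Lam] holds the integer vectors [x] for which [x / q] is the coordinate vector of a lattice
   point; [gam l] is [q] times the coordinate vector of the [l]-th representative. *)
pose Lam (x : 'rV[int]_e) := exists z : 'rV[int]_n, \sum_i x 0 i *: v (hs i) = q%:Z *: z.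
pose gam (l : 'I_(size (s E))) : 'rV[int]_e :=
  \row_i (M%:Z * D * ((s E)`_l *m \adj (Y h)) 0 (ks i)).
have qcancel (z z' : 'rV[int]_n) : q%:Z *: z = q%:Z *: z' -> z = z'.
  move=> /rowP Eq; apply/rowP => i; have := Eq i; rewrite !mxE => /mulfI; apply.
  by rewrite eqz_nat -lt0n.
have gamE l : \sum_i gam l 0 i *: v (hs i) = q%:Z *: (s E)`_l.
  have [t [Ez _ t0]] := sT _ (mem_nth 0 (ltn_ord l)).
  have tE j : j \notin E -> t j = 0 by move=> jE; apply: t0; rewrite !inE.
  set z := (s E)`_l in Ez *.
  have -> : q%:Z *: z = (M%:Z * D) *: ((z *m \adj (Y h)) *m Y h).
    by rewrite -mulmxA mul_adj_mx mul_mx_scalar scalerA PoszM D2E mulrA.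
  rewrite mulmx_sum_row scaler_sumr [RHS](bigID (mem I)) /= [X in _ + X]big1 ?addr0; last first.
    by move=> k kI; rewrite (adj_coord_image hinj Ez tE kI) scale0r scaler0.
  rewrite [RHS]big_enum_val; apply: eq_bigr => i _.
  by rewrite [gam l 0 i]mxE scalerA rowK.
have := @minkowski_second_cube e q (size (s E)) A a Lam gam dA q0.
have -> : (\prod_k a k = \prod_(k in I) b k * D2 ^ e)%N.
  by rewrite big_split /= prod_nat_const card_ord [in RHS]big_enum_val.
have D2e : (0 < D2 ^ e)%N by rewrite expn_gt0 D2_gt0.
rewrite /q expnMn mulnA (leq_pmul2r D2e); apply.
- by move=> k; rewrite muln_gt0 b_gt0.
- by move=> i j ij; rewrite leq_mul2r b_mono ?orbT // ks_le.
- move=> x y [z Ez] [z' Ez']; exists (z - z'); rewrite scalerBr -Ez -Ez' -sumrB.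
  by apply: eq_bigr => i _; rewrite !mxE scalerBl.
- move=> y; exists (\sum_i y 0 i *: v (hs i)); rewrite scaler_sumr.
  by apply: eq_bigr => i _; rewrite mxE scalerA.
- move=> x [z Ez] t; rewrite xA Ez => nz.
  (* If all coordinates of [x] are below [a t], those of [z] are below [b (ks t) / M]; then [z] lies
     in [W (ks t)] and its form vanishes. *)
  apply/existsP; apply: contraNT nz; rewrite negb_exists => /forallP xs.
  rewrite -scalemxAl fW ?scaler0 ?mxE //.
  exists (fun j => \sum_(i | hs i == j) (x 0 i)%:~R / q%:R).
    rewrite /comb (sum_spread hs (fun i => (x 0 i)%:~R / q%:R) (fun j => toR R (v j))).
    have qR : q%:R != 0 :> R by rewrite pnatr_eq0 -lt0n.
    apply: (scalerI qR); rewrite -[q%:R]/((q%:Z)%:~R) -toRZ -Ez toR_sum scaler_sumr.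
    apply: eq_bigr => i _; rewrite toRZ scalerA; congr (_ *: _).
    by rewrite -[(q%:Z)%:~R]/(q%:R) mulrC divfK.
  move=> j; have [/existsP[i /eqP <-]|/existsPn nj] := boolP [exists i, hs i == j].
    rewrite (sum_fiber_inj (fun i => (x 0 i)%:~R / q%:R)) // normrM normfV.
    have := xs i; rewrite -ltNge => /ltW; rewrite -(ler_int R) intr_norm => h1.
    rewrite (ger0_norm (ler0n R q)) ler_pdivrMr ?ltr0n //; apply: le_trans h1 _.
    rewrite -[((a t)%:Z)%:~R]/((a t)%:R) /a /q !natrM [X in _ <= X]mulrA divfK //.
    by rewrite pnatr_eq0 -lt0n.
  by rewrite big_pred0 ?normr0 ?divr_ge0 // => i; apply/negbTE/nj.
- by move=> l; exists (s E)`_l; apply: gamE.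
- move=> i j y Ey; apply/val_inj/eqP; rewrite -(nth_uniq 0 (ltn_ord i) (ltn_ord j) su).
  apply/eqP/si; rewrite ?mem_nth //.
  exists (fun l => \sum_(t | hs t == l) y 0 t).
    move=> l lE; rewrite big_pred0 // => t; apply: contraNF lE => /eqP <-; exact: hsE.
  rewrite scale1r /combz (sum_spread hs (fun t => y 0 t) v); apply: qcancel.
  rewrite scalerBr -!gamE -sumrB scaler_sumr; apply: eq_bigr => t _.
  by rewrite -scalerBl scalerA; congr (_ *: _); have /rowP/(_ t) := Ey; rewrite !mxE.
Qed.
End Parallelepiped.

(** * Averaging over the subsets of size [n] *)

(** A superset of [E] amounts to a choice of [n - i] elements of the complement. *)
Lemma card_supersets (m n i : nat) (E : {set 'I_m}) : #|E| = i -> (i <= n)%N ->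
  #|[set J : {set 'I_m} | (E \subset J) && (#|J| == n)]| = 'C(m - i, n - i).
Proof.
move=> Ei le_in.
have -> : [set J : {set 'I_m} | (E \subset J) && (#|J| == n)] =
    (fun F => E :|: F) @: [set F : {set 'I_m} | F \subset ~: E & #|F| == (n - i)%N].
  apply/setP => J; rewrite !inE; apply/andP/imsetP => [[EJ /eqP Jn]|[F]].
    exists (J :\: E); rewrite ?inE.
      rewrite finset.setDE finset.subsetIr /= -finset.setDE cardsD Jn.
      by rewrite (finset.setIidPr EJ) Ei eqxx.
    by rewrite -[LHS](finset.setID J E) (finset.setIidPr EJ).
  rewrite inE => /andP[FE /eqP Fn] ->; split; first exact: finset.subsetUl.
  have /eqP d : E :&: F == finset.set0 by rewrite finset.setI_eq0 disjoint_sym finset.disjoints_subset.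
  by rewrite cardsU d cards0 subn0 Ei Fn subnKC.
rewrite card_in_imset.
  by rewrite cards_draws -Ei cardsCs finset.setCK card_ord.
move=> F G; rewrite !inE => /andP[FE _] /andP[GE _] FG.
have H (H : {set 'I_m}) : H \subset ~: E -> (E :|: H) :\: E = H.
  by move=> HE; rewrite finset.setDUl finset.setDv finset.set0U finset.setDE; apply/finset.setIidPl.
by rewrite -(H F FE) FG H.
Qed.

Lemma double_count (R : realDomainType) (m n i : nat) (G : {set 'I_m} -> R) : (i <= n)%N ->
  \sum_(J : {set 'I_m} | #|J| == n) \sum_(E : {set 'I_m} | (E \subset J) && (#|E| == i)) G E
  = 'C(m - i, n - i)%:R * \sum_(E : {set 'I_m} | #|E| == i) G E.
Proof.
move=> le_in; rewrite (exchange_big_dep (fun E : {set 'I_m} => #|E| == i)) /=; last first.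
  by move=> J E _ /andP[].
rewrite mulr_sumr; apply: eq_bigr => E /eqP Ei.
rewrite (eq_bigl (mem [set J : {set 'I_m} | (E \subset J) && (#|J| == n)])); last first.
  by move=> J; rewrite !inE Ei eqxx andbT andbC.
by rewrite sumr_const (card_supersets Ei le_in) mulr_natl.
Qed.

(** Follows from [double_count] for the constant function 1. *)
Lemma bin_superset_id (m n i : nat) : (i <= n)%N ->
  ('C(m, n) * 'C(n, i) = 'C(m - i, n - i) * 'C(m, i))%N.
Proof.
move=> le_in; apply/eqP; rewrite -(eqr_nat int) !natrM.
have := @double_count int m n i (fun=> 1) le_in; rewrite sumr_const.
have -> : #|[pred E : {set 'I_m} | #|E| == i]| = 'C(m, i).
  by rewrite -[X in 'C(X, i)](card_ord m) -card_draws; apply: eq_card => E; rewrite !inE.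
move=> <-; rewrite (eq_bigr (fun=> 'C(n, i)%:R)); last first.
  move=> J /eqP Jn; rewrite sumr_const -[X in 'C(X, i)]Jn -cards_draws.
  by congr (_%:R); apply: eq_card => E; rewrite !inE.
rewrite sumr_const -natrM.
have -> : #|[pred J : {set 'I_m} | #|J| == n]| = 'C(m, n).
  by rewrite -[X in 'C(X, n)](card_ord m) -card_draws; apply: eq_card => E; rewrite !inE.
by rewrite -mulrnA mulnC.
Qed.

(** * Successive minima of [DZ] and their rational approximation *)

Lemma le_of_pow_slack (R : realFieldType) (i : nat) (X Y : R) : (0 < i)%N -> 0 <= X ->
  (forall d : R, 0 < d < 1 -> (1 - d) ^+ i * X <= Y) -> X <= Y.
Proof.
move=> i0 X0 h; rewrite leNgt; apply/negP => YX.
have bern (d : R) : 0 <= d <= 1 -> 1 - i%:R * d <= (1 - d) ^+ i.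
  move=> /andP[d0 d1]; elim: (i) => [|j IH]; first by rewrite mul0r subr0 expr0.
  rewrite exprS; apply: le_trans (ler_wpM2l _ IH); last by rewrite subr_ge0.
  have j0 : 0 <= j%:R :> R by rewrite ler0n.
  rewrite -natr1; nra.
have Y0 : 0 <= Y.
  by apply: le_trans (h (1 / 2) _); [rewrite mulr_ge0 ?exprn_ge0 //; lra | lra].
have Xp : 0 < X by apply: le_lt_trans YX.
have i1 : 1 <= i%:R :> R by rewrite ler1n.
(* With this [d] the Bernoulli loss [i * d * X] is only half of the gap [X - Y]. *)
pose d := (X - Y) / (2 * i%:R * X).
have den : 0 < 2 * i%:R * X by rewrite !mulr_gt0 ?ltr0n.
have d0 : 0 < d by rewrite divr_gt0 // subr_gt0.
have d1 : d < 1 by rewrite ltr_pdivrMr // mul1r; nra.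
have id : i%:R * d * X = (X - Y) / 2.
  by rewrite /d; field; rewrite !gt_eqF ?ltr0n.
have := h d; rewrite d0 d1 => /(_ isT) h2; have := bern d; rewrite (ltW d0) (ltW d1) => /(_ isT) h1.
have : (1 - i%:R * d) * X <= (1 - d) ^+ i * X by rewrite ler_wpM2r.
by rewrite mulrBl mul1r id; lra.
Qed.

Section SuccMin.
Variables (R : realType) (n m : nat) (v : 'I_m -> 'rV[int]_n).
Hypothesis gp : general_position R v.
Hypothesis nm : (n <= m)%N.

Let K := diffset (zonotope v : classical_sets.set 'rV[R]_n).
Let lam j : R := succ_min K j.
Let S j : classical_sets.set R := [set l | 0 < l /\ affdim_ge (dilate l K `&` @lattice_pts R n) j]%classic.

(** A coefficient [u] in [[-1, 1]] is the difference of [(1 + u) / 2] and [(1 - u) / 2], both in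
    [[0, 1]]. *)
Lemma comb_dilate_diffset (l : R) t : 0 < l -> (forall j, `|t j| <= l) -> dilate l K (comb v t).
Proof.
move=> l0 tl; have ln : l != 0 by rewrite gt_eqF.
exists (comb v (fun j => l^-1 * t j)); split; last by rewrite -combZ; apply: eq_bigr => j _; rewrite mulVKf.
exists (comb v (fun j => (1 + l^-1 * t j) / 2)), (comb v (fun j => (1 - l^-1 * t j) / 2)).
have b j : -1 <= l^-1 * t j <= 1.
  by rewrite -ler_norml normrM normfV (gtr0_norm l0) mulrC ler_pdivrMr // mul1r.
split; last split.
- exists (fun j => (1 + l^-1 * t j) / 2); split=> // j; have := b j; move: (_ * t j) => u; lra.
- exists (fun j => (1 - l^-1 * t j) / 2); split=> // j; have := b j; move: (_ * t j) => u; lra.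
- by rewrite -combN -combD; apply: eq_bigr => j _; congr (_ *: _); field.
Qed.

Lemma affdim_of_free (T : classical_sets.set 'rV[R]_n) d (p : 'I_d -> 'rV[R]_n) :
  T 0 -> (forall j, T (p j)) -> row_free (\matrix_(j < d) p j) -> affdim_ge T d.
Proof.
move=> T0 Tp pf; exists (fun i => if unlift ord0 i is Some j then p j else 0).
split; first by move=> i; case: unlift.
rewrite (_ : \matrix_(j < d) _ = \matrix_(j < d) p j) //.
by apply/row_matrixP => j; rewrite !rowK liftK unlift_none subr0.
Qed.

Lemma affdimS (T : classical_sets.set 'rV[R]_n) d : affdim_ge T d.+1 -> affdim_ge T d.
Proof.
move=> [p [Tp pf]].
exists (fun i => p (widen_ord (leqnSn d.+1) i)); split; first by move=> j; apply: Tp.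
have := row_free_rowsub (f := widen_ord (leqnSn d)) _ pf.
rewrite (_ : rowsub _ _ = \matrix_(j < d) (p (widen_ord (leqnSn d.+1) (lift ord0 j))
                                        - p (widen_ord (leqnSn d.+1) ord0))).
  by apply=> i j /(congr1 val) /= ij; apply: val_inj.
apply/matrixP => i j; rewrite !mxE; congr (p _ _ _ - p _ _ _); exact: val_inj.
Qed.

Lemma affdim_neq0 (T : classical_sets.set 'rV[R]_n) d :
  affdim_ge T d.+1 -> exists2 x, T x & x != 0.
Proof.
move=> [p [Tp pf]].
have [p0|p0] := eqVneq (p ord0) 0; last by exists (p ord0).
exists (p (lift ord0 ord0)) => //; apply/negP => /eqP p1.
move: pf => /row_freeP[B /matrixP /(_ ord0 ord0)].
rewrite !mxE eqxx big1 => [/eqP|j _]; first by rewrite eq_sym oner_eq0.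
by rewrite !mxE p1 p0 !mxE subr0 mul0r.
Qed.

Let S_lb j : classical_sets.has_lbound (S j).
Proof. by exists 0 => l [/ltW]. Qed.

Let zero_in l : (dilate l K `&` @lattice_pts R n)%classic 0.
Proof.
split; last by exists 0; rewrite toR0.
exists 0; split; last by rewrite scaler0.
exists 0, 0; rewrite subr0; split; [|split=> //];
  exists (fun=> 0); split=> [i|]; rewrite ?lexx ?ler01 //;
  by rewrite big1 // => i _; rewrite scale0r.
Qed.

(** Independent points, together with 0, would put [l] into the set whose infimum is [lam k.+1]. *)
Lemma succ_min_free (k : nat) (l : R) (p : 'I_k.+1 -> 'rV[int]_n) : 0 < l -> l < lam k.+1 ->
  (forall j, exists2 t, toR R (p j) = comb v t & forall j, `|t j| <= l) ->
  ~ row_free (\matrix_(j < k.+1) toR R (p j)).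
Proof.
move=> l0 llam pW pf; suff : lam k.+1 <= l by rewrite leNgt llam.
apply: ge_inf; first exact: S_lb.
split=> //; apply: affdim_of_free pf => [|j]; first exact: zero_in.
by split; [have [t -> tl] := pW j; apply: comb_dilate_diffset | exists (p j)].
Qed.

(** Keeps [inf] away from its default value: the factor 1 is admissible because [DZ] contains the
    generators. *)
Let S_neq0 j : (j <= n)%N -> (S j !=set0)%classic.
Proof.
move=> jn; exists 1; split=> //.
pose h (i : 'I_j) : 'I_m := widen_ord nm (widen_ord jn i).
apply: (@affdim_of_free _ _ (fun i => toR R (v (h i)))); first exact: zero_in.
  move=> i; split; last by exists (v (h i)).
  rewrite -[toR _ _]scale1r -comb1; apply: comb_dilate_diffset => // l.
  by case: ifP; rewrite ?normr1 ?normr0.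
have := row_free_rowsub (f := widen_ord jn) _ (gp (f := widen_ord nm) _).
rewrite (_ : rowsub _ _ = \matrix_(i < j) toR R (v (h i))).
  by apply=> a b /(congr1 val) /= ab; apply: val_inj.
by apply/matrixP => a b; rewrite !mxE.
Qed.

Lemma succ_min_mono i j : (i <= j)%N -> (j <= n)%N -> lam i <= lam j.
Proof.
elim: j => [|j IH]; first by rewrite leqn0 => /eqP ->.
rewrite leq_eqVlt => /orP[/eqP -> //|ij] jn.
apply: le_trans (IH ij (ltnW jn)) _.
apply: lb_le_inf; first exact: S_neq0.
by move=> l [l0 /affdimS la]; apply: ge_inf; [apply: S_lb | split].
Qed.

(** For [l < B^-1] the points of [l DZ] have coordinates below 1 in absolute value, so 0 is the only
    lattice point among them. *)
Lemma succ_min_gt0 : exists2 c : R, 0 < c & forall j, (j < n)%N -> c <= lam j.+1.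
Proof.
pose B : R := 1 + \sum_j \sum_i `|toR R (v j) 0 i|.
have B0 : 0 < B by rewrite ltr_pwDl // sumr_ge0 // => j _; rewrite sumr_ge0.
exists B^-1; first by rewrite invr_gt0.
move=> j jn; apply: lb_le_inf; first exact: S_neq0.
move=> l [l0 /affdim_neq0[x [[y [[y1 [y2 [[t [t01 Ey1]] [[u [u01 Ey2]] Ey]]]] Ex]] [z Ez]] x0]].
rewrite leNgt; apply/negP => lB; move/negP: x0; apply; apply/eqP.
suff : z = 0 by rewrite Ez => ->; rewrite toR0.
apply/rowP => i; rewrite mxE; apply/eqP; rewrite -normr_le0 -ltzD1 add0r -(ltr_int R) intr_norm.
have -> : (z 0 i)%:~R = l * (\sum_j (t j - u j) * toR R (v j) 0 i).
  have -> : (z 0 i)%:~R = x 0 i by rewrite Ez mxE.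
  rewrite Ex Ey Ey1 Ey2 -sumrB mxE summxE; congr (_ * _); apply: eq_bigr => a _.
  by rewrite -scalerBl mxE.
rewrite normrM (gtr0_norm l0).
apply: (@le_lt_trans _ _ (l * \sum_j \sum_i `|toR R (v j) 0 i|)).
  rewrite ler_pM2l // (le_trans (ler_norm_sum _ _ _)) // ler_sum // => a _.
  rewrite normrM (bigD1 i) //= -[X in X <= _]addr0 lerD //; last by rewrite sumr_ge0.
  rewrite -[X in _ <= X]mul1r ler_wpM2r //.
  by have := t01 a; have := u01 a; rewrite ler_norml; lra.
apply: (@lt_trans _ _ (l * B)); first by rewrite ltr_pM2l // ltrDr.
by rewrite -(divff (lt0r_neq0 B0)) mulrC ltr_pM2l.
Qed.

(** Here [b k] is the integer part of [M * (1 - d / 2) * lam k.+1]. One half of [d] gives the strict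
    upper bound; the other absorbs the rounding, as [M > 2 / (d * c)]. *)
Lemma rational_approx (d : R) : 0 < d < 1 -> exists (M : nat) (b : 'I_n -> nat),
  [/\ (0 < M)%N, forall k, (0 < b k)%N, forall i j : 'I_n, (i <= j)%N -> (b i <= b j)%N
    & forall k : 'I_n, (1 - d) * lam k.+1 <= (b k)%:R / M%:R < lam k.+1].
Proof.
move=> /andP[d0 d1]; have [c c0 lc] := succ_min_gt0.
pose M := (Num.bound (2 / (d * c))).+1.
have Mc : 2 / (d * c) < M%:R.
  have := archi_boundP (x := 2 / (d * c)) => h.
  by apply: lt_trans (h _) _; [rewrite divr_ge0 // mulr_ge0 // ltW | rewrite ltr_nat].
have MR : 0 < M%:R :> R by rewrite ltr0n.
pose x (k : nat) := M%:R * ((1 - d / 2) * lam k.+1).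
have lp k : (k < n)%N -> 0 < lam k.+1 by move=> /lc; apply: lt_le_trans.
have x0 k : (k < n)%N -> 0 <= x k.
  move=> /lp l0; rewrite !mulr_ge0 //; [lra|exact: ltW].
have slack k : (k < n)%N -> M%:R * ((1 - d) * lam k.+1) + 1 <= x k.
  move=> kn; have := lc k kn; move: Mc; rewrite ltr_pdivrMr ?mulr_gt0 // => Mc' h.
  have : M%:R * (d * c) <= M%:R * (d * lam k.+1) by rewrite !ler_wpM2l // ltW.
  by rewrite /x; lra.
exists M, (fun k : 'I_n => Num.truncn (x k)).
have main (k : 'I_n) : (1 - d) * lam k.+1 <= (Num.truncn (x k))%:R / M%:R < lam k.+1.
  have /andP[h1 h2] := truncn_itv (x0 k (ltn_ord k)).
  have l0 := lp k (ltn_ord k).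
  rewrite ler_pdivlMr // ltr_pdivrMr //; apply/andP; split.
    have := slack k (ltn_ord k); move: h2; rewrite -natr1; lra.
  apply: le_lt_trans h1 _; rewrite /x mulrC ltr_pM2r //.
  by rewrite gtr_pMl //; lra.
split=> //.
- move=> k; have /andP[h _] := main k; have l0 := lp k (ltn_ord k).
  rewrite -(ltr_nat R) -(@pmulr_lgt0 _ M%:R^-1) ?invr_gt0 //; apply: lt_le_trans h.
  by rewrite mulr_gt0 // subr_gt0.
- move=> i j ij; apply: le_truncn; rewrite /x !ler_pM2l //; last by lra.
  exact: succ_min_mono.
Qed.
End SuccMin.

(** * Ehrhart coefficients and the final averaging *)

Lemma zonotope_dim_le (R : realType) n m (v : 'I_m -> 'rV[int]_n) :
  affdim_ge (zonotope v : classical_sets.set 'rV[R]_n) n -> (n <= m)%N.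
Proof.
move=> [p [pZ pf]]; have [t tP] := choice pZ.
rewrite -(eqP (pf : \rank _ == n)).
have -> : \matrix_(j < n) (p (lift ord0 j) - p ord0) =
    (\matrix_(j < n, i < m) (t (lift ord0 j) i - t ord0 i)) *m \matrix_(i < m) toR R (v i).
  apply/row_matrixP => j; rewrite rowK row_mul mulmx_sum_row.
  rewrite (tP (lift ord0 j)).2 (tP ord0).2 -sumrB; apply: eq_bigr => i _.
  by rewrite rowK !mxE -scalerBl.
by apply: leq_trans (mxrankM_maxr _ _) _; apply: rank_leq_row.
Qed.

Lemma poly_eq_on_nat (R : numDomainType) (p q : {poly R}) :
  (forall k, (0 < k)%N -> p.[k%:R] = q.[k%:R]) -> p = q.
Proof.
move=> pq; apply/eqP; rewrite -subr_eq0; apply/negPn/negP => nz.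
pose rs := [seq k.+1%:R : R | k <- iota 0 (size (p - q))].
have := max_poly_roots (rs := rs) nz _ _; rewrite size_map size_iota ltnn => H.
apply: notF; apply: H.
  apply/allP => _ /mapP[k _ ->]; by rewrite /root hornerD hornerN pq // subrr.
by rewrite map_inj_uniq ?iota_uniq // => a b /(mulrIn (oner_neq0 R)) [].
Qed.

Section Main.
Variables (R : realType) (n m : nat) (v : 'I_m -> 'rV[int]_n).

(** The count is polynomial in [k] and agrees with [p] at all positive integers. The inequality
    comes from extending the sum to dependent sets, which adds nonnegative terms. *)
Lemma ehrhart_coef (p : {poly R}) (s : {set 'I_m} -> seq 'rV[int]_n) i :
  (forall k : nat, (0 < k)%N -> exists N : nat,
     lattice_card (dilate k%:R (zonotope v : classical_sets.set 'rV[R]_n)) N /\ p.[k%:R] = N%:R) ->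
  (forall k N, (0 < k)%N ->
     lattice_card (dilate k%:R (zonotope v : classical_sets.set 'rV[R]_n)) N ->
     N = (\sum_(E : {set 'I_m} | `[< indep R v E >]) k ^ #|E| * size (s E))%N) ->
  p`_i <= \sum_(E : {set 'I_m} | #|E| == i) (size (s E))%:R.
Proof.
move=> ep cnt.
have -> : p = \sum_(E : {set 'I_m} | `[< indep R v E >]) (size (s E))%:R *: 'X^#|E|.
  apply: poly_eq_on_nat => k k0; have [N [hN ->]] := ep k k0.
  rewrite (cnt k N k0 hN) natr_sum horner_sum; apply: eq_bigr => E _.
  by rewrite hornerZ hornerXn natrM natrX mulrC.
rewrite coef_sum [X in _ <= X]big_mkcond [X in X <= _]big_mkcond; apply: ler_sum => E _ /=.
rewrite coefZ coefXn eq_sym; case: asboolP => _; case: eqP => _ //=;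
  by rewrite ?mulr1 ?mulr0.
Qed.

Hypothesis gp : general_position R v.
Hypothesis nm : (n <= m)%N.
Variable s : {set 'I_m} -> seq 'rV[int]_n.
Hypothesis sP : forall E, indep R v E ->
  transversal (fun z => slab v 1%:R finset.set0 E (toR R z)) (sublattice v 1 E) (s E).

(** Subsets of [J] are images of subsets [I] under the bijection [h0 \o pi], so the bounds for the
    single [I] add up to [sigmaZ], up to the factor [(1 - d) ^+ i]. As [pi] may change with [d], the
    limit is taken on the whole sum, where [pi] no longer appears. *)
Lemma basis_sum_le (J : {set 'I_m}) i : (0 < i)%N -> #|J| = n ->
  \sum_(E : {set 'I_m} | (E \subset J) && (#|E| == i)) (size (s E))%:R <= sigmaZ R v i.
Proof.
move=> i0 Jn.
pose h0 (j : 'I_n) : 'I_m := enum_val (cast_ord (esym Jn) j).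
have h0_inj : injective h0 by move=> a b /enum_val_inj /cast_ord_inj.
have h0J j : h0 j \in J by apply: enum_valP.
apply: (@le_of_pow_slack _ i) => //; first by apply: sumr_ge0.
move=> d d01; have [M [b [M0 b0 bm bP]]] := rational_approx gp nm d01.
have Wd (k : 'I_n) (p : 'I_k.+1 -> 'rV[int]_n) :
    (forall j, exists2 t, toR R (p j) = comb v t & forall j, `|t j| <= (b k)%:R / M%:R) ->
    ~ row_free (\matrix_(j < k.+1) toR R (p j)).
  apply: succ_min_free; first by rewrite divr_gt0 ?ltr0n.
  by have /andP[] := bP k.
have [pi pi_inj piP] := parallelepiped_bound gp h0_inj M0 b0 bm Wd sP.
have hinj : injective (h0 \o pi) by apply: inj_comp.
have imJ : (h0 \o pi) @: [set: 'I_n] = J.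
  apply/eqP; rewrite finset.eqEcard card_imset // cardsT card_ord Jn leqnn andbT.
  by apply/fintype.subsetP => _ /imsetP[j _ ->]; apply: h0J.
have -> : \sum_(E : {set 'I_m} | (E \subset J) && (#|E| == i)) (size (s E))%:R =
    \sum_(I : {set 'I_n} | #|I| == i) (size (s ((h0 \o pi) @: I)))%:R :> R.
  rewrite (eq_bigl (mem [set ((h0 \o pi) @: I) | I : {set 'I_n} in [set I : {set 'I_n} | #|I| == i]])).
    rewrite big_imset /=; last by move=> I I' _ _; apply: imset_inj.
    by apply: eq_bigl => I; rewrite inE.
  move=> E; apply/andP/imsetP => [[EJ /eqP Ei]|[I]].
    have EE : (h0 \o pi) @: ((h0 \o pi) @^-1: E) = E.
      apply/setP => x; apply/imsetP/idP => [[y]|xE]; first by rewrite inE => ? ->.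
      have := fintype.subsetP EJ x xE; rewrite -imJ => /imsetP[y _ xy].
      by exists y => //; rewrite inE -xy.
    by exists ((h0 \o pi) @^-1: E); rewrite ?EE // inE -(card_imset _ hinj) EE Ei.
  rewrite inE => /eqP Ii ->; rewrite card_imset // Ii eqxx; split=> //.
  by rewrite -imJ; apply: imsetS; apply: finset.subsetT.
rewrite mulr_sumr /sigmaZ /elem_sym; apply: ler_sum => I /eqP Ii.
have bI : 0 < \prod_(k in I) (b k)%:R :> R by apply: prodr_gt0 => k _; rewrite ltr0n.
have h1 : (size (s ((h0 \o pi) @: I)))%:R * \prod_(k in I) (b k)%:R <= M%:R ^+ i :> R.
  by rewrite -natr_prod -natrM -natrX ler_nat -Ii; apply: piP.
set lam := fun k : 'I_n => succ_min (diffset (zonotope v)) k.+1 : R.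
have l0 k : 0 < lam k.
  have /andP[_] := bP k; apply: lt_trans; by rewrite divr_gt0 ?ltr0n.
have lI : 0 < \prod_(k in I) lam k by apply: prodr_gt0.
have h2 : (1 - d) ^+ i * \prod_(k in I) lam k * M%:R ^+ i <= \prod_(k in I) (b k)%:R.
  rewrite -Ii -!prodr_const -!big_split /=; apply: ler_prod => k _.
  have /andP[h _] := bP k; move: h; rewrite ler_pdivlMr ?ltr0n // => h.
  have d1 : 0 <= 1 - d by have /andP[_ /ltW] := d01; rewrite subr_ge0.
  by rewrite h andbT !mulr_ge0 // ltW.
rewrite prodfV -[X in _ <= X]mul1r ler_pdivlMr //.
have Mi : 0 < M%:R ^+ i :> R by rewrite exprn_gt0 ?ltr0n.
rewrite -(ler_pM2r Mi) mul1r; apply: le_trans h1.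
rewrite [X in X <= _](_ : _ = (size (s ((h0 \o pi) @: I)))%:R *
  ((1 - d) ^+ i * \prod_(k in I) lam k * M%:R ^+ i)); last by rewrite /lam; ring.
by rewrite ler_wpM2l.
Qed.
End Main.

Unset Implicit Arguments.
Theorem theorem2p4 (R : realType) (n m : nat) (v : 'I_m -> 'rV[int]_n)
    (p : {poly R}) :
  @general_position R n m v ->
  affdim_ge (@zonotope R n m v) n ->
  (forall k : nat, (0 < k)%N ->
     exists N : nat, lattice_card (dilate k%:R (@zonotope R n m v)) N /\
                     p.[k%:R] = N%:R) ->
  forall i : nat, (1 <= i <= n)%N ->
    p`_i <= ('C(m, i)%:R / 'C(n, i)%:R) * @sigmaZ R n m v i.
Proof.
move=> gp dimZ ehr i /andP[i0 le_in].
have nm := zonotope_dim_le dimZ.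
have [s [sP cnt]] := transversal_count R v.
apply: le_trans (ehrhart_coef i ehr cnt) _.
set X := \sum_(E | _) _.
(* Summing the bound for one basis over all [J] counts each [E] once per superset of size [n]. *)
have h : 'C(m - i, n - i)%:R * X <= 'C(m, n)%:R * sigmaZ R v i.
  rewrite -(double_count _ le_in).
  apply: (@le_trans _ _ (\sum_(J : {set 'I_m} | #|J| == n) sigmaZ R v i)).
    by apply: ler_sum => J /eqP Jn; apply: basis_sum_le.
  rewrite sumr_const.
  have -> : #|[pred J : {set 'I_m} | #|J| == n]| = 'C(m, n).
    by rewrite -[X in 'C(X, n)](card_ord m) -card_draws; apply: eq_card => E; rewrite !inE.
  by rewrite mulr_natl.
have c1 : 0 < 'C(m - i, n - i)%:R :> R by rewrite ltr0n bin_gt0 leq_sub2r.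
have c2 : 0 < 'C(n, i)%:R :> R by rewrite ltr0n bin_gt0.
rewrite mulrAC ler_pdivlMr // -(ler_pM2l c1) mulrA.
apply: le_trans (ler_wpM2r (ltW c2) h) _.
(* The ratio of ['C(m, n)] to ['C(m - i, n - i)] equals that of ['C(m, i)] to ['C(n, i)]. *)
by rewrite mulrAC -natrM (bin_superset_id m le_in) natrM mulrA.
Qed.
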